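(* Let $K$ be a field, let $m,n\ge 1$, let $X$ be an $m\times n$ matrix of indeterminates, let $Y$ be the generic $n\times 1$ column matrix with entries $y_1,\dots,y_n$, and let $R=K[[x_{ij},y_j]]$ be the power series ring over $K$ in the indeterminates occurring in $X$ and $Y$. Suppose that one of the following holds: (i) $m=n$ and $X=(x_{ij})$ is generic or generic symmetric; (ii) $m=n+1$ and $X=(x_{ij})$ is generic. Then the ideal $I_1(XY)$ of $R$ is normal.
   Context: ''Generic'' means that the entries $x_{ij}$ ($1\le i\le m$, $1\le j\le n$) of $X$ are distinct indeterminates over $K$. ''Generic symmetric'' (for $m=n$) means that $x_{ij}=x_{ji}$ and the $x_{ij}$ with $i\le j$ are distinct indeterminates. The $y_j$ are further distinct indeterminates. $I_1(XY)=\langle g_1,\dots,g_m\rangle$ with $g_i=\sum_{j=1}^n x_{ij}y_j$ is the ideal of $R$ generated by the entries of $XY$. An ideal $I$ is normal if all its powers $I^k$, $k\ge 1$, are integrally closed. *)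

(* Defs.v *)
From HB Require Import structures.
From mathcomp Require Import all_boot all_order all_algebra.
From mathcomp Require Import boolp classical_sets.

Set Implicit Arguments.
Unset Strict Implicit.
Unset Printing Implicit Defensive.

Import GRing.Theory.
Local Open Scope ring_scope.

(* A multi-index is a function V -> nat; coef f a is the coefficient of the
   monomial \prod_v v ^ (a v). *)
Record mpseries (K : Type) (V : finType) := MPSeries
  { coef : {ffun V -> nat} -> K }.

HB.instance Definition _ (K : Type) (V : finType) := gen_eqMixin (mpseries K V).
HB.instance Definition _ (K : Type) (V : finType) :=
  gen_choiceMixin (mpseries K V).

Section PowerSeriesRing.
Variables (K : comNzRingType) (V : finType).
Implicit Types (f g h : mpseries K V) (a b c : {ffun V -> nat}).

Definition mps0 : mpseries K V := MPSeries (fun=> 0).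
Definition mps1 : mpseries K V := MPSeries (fun a => (a == [ffun=> 0%N])%:R).
Definition mpsN f : mpseries K V := MPSeries (fun a => - coef f a).
Definition mpsD f g : mpseries K V := MPSeries (fun a => coef f a + coef g a).

(* Cauchy product: b ranges over the multi-indices with b <= a pointwise. *)
Definition mpsM f g : mpseries K V := MPSeries (fun a =>
  \sum_(b : {dffun forall v : V, 'I_(a v).+1})
    coef f [ffun v => b v : nat] * coef g [ffun v => (a v - b v)%N]).

Definition mpsX (v : V) : mpseries K V :=
  MPSeries (fun a => (a == [ffun w => (w == v) : nat])%:R).

Lemma mpseriesP f g : (forall a, coef f a = coef g a) -> f = g.
Proof. by case: f g => [f] [g] /= /funext ->. Qed.

Let madd a b : {ffun V -> nat} := [ffun v => (a v + b v)%N].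

Let splits a : seq ({ffun V -> nat} * {ffun V -> nat}) :=
  [seq ([ffun v => b v : nat], [ffun v => (a v - b v)%N])
     | b : {dffun forall v : V, 'I_(a v).+1}].

Let mem_splits a p : (p \in splits a) = (madd p.1 p.2 == a).
Proof.
apply/idP/eqP => [/mapP[b _ ->] | ].
  by apply/ffunP => v; rewrite !ffunE subnKC // -ltnS ltn_ord.
case: p => b c /= <-; apply/mapP.
exists [ffun v => inord (b v)] => //; first by rewrite mem_enum.
by congr pair; apply/ffunP => v; rewrite !ffunE inordK ?ffunE ?addKn // ltnS leq_addr.
Qed.

Let splits_uniq a : uniq (splits a).
Proof.
rewrite map_inj_uniq ?enum_uniq // => b c [/ffunP bc _].
by apply/ffunP => v; apply/val_inj; have := bc v; rewrite !ffunE.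
Qed.

Lemma mpsME f g a :
  coef (mpsM f g) a = \sum_(p <- splits a) coef f p.1 * coef g p.2.
Proof. by rewrite big_map big_enum. Qed.

Lemma mpsDA : associative mpsD.
Proof. by move=> f g h; apply: mpseriesP => a /=; rewrite addrA. Qed.

Lemma mpsDC : commutative mpsD.
Proof. by move=> f g; apply: mpseriesP => a /=; rewrite addrC. Qed.

Lemma mps0D : left_id mps0 mpsD.
Proof. by move=> f; apply: mpseriesP => a /=; rewrite add0r. Qed.

Lemma mpsND : left_inverse mps0 mpsN mpsD.
Proof. by move=> f; apply: mpseriesP => a /=; rewrite addNr. Qed.

Lemma mpsMC : commutative mpsM.
Proof.
move=> f g; apply: mpseriesP => a; rewrite !mpsME.
have sw : perm_eq (splits a) [seq (p.2, p.1) | p <- splits a].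
  apply: uniq_perm => //; first by rewrite map_inj_uniq // => -[? ?] [? ?] [-> ->].
  move=> [b c]; apply/idP/mapP => [bc | [[b' c'] bc [-> ->]]].
    exists (c, b) => //; move: bc; rewrite !mem_splits /= => /eqP <-.
    by apply/eqP/ffunP => v; rewrite !ffunE addnC.
  move: bc; rewrite !mem_splits /= => /eqP <-.
  by apply/eqP/ffunP => v; rewrite !ffunE addnC.
by rewrite (perm_big _ sw) big_map; apply: eq_bigr => p _; rewrite mulrC.
Qed.

Lemma mpsMA : associative mpsM.
Proof.
move=> f g h; apply: mpseriesP => a; rewrite !mpsME.
transitivity (\sum_(t <- [seq (p.1, q.1, q.2) | p <- splits a, q <- splits p.2])
                coef f t.1.1 * coef g t.1.2 * coef h t.2).
  rewrite big_allpairs_dep; apply: eq_bigr => p _.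
  by rewrite mpsME mulr_sumr; apply: eq_bigr => q _; rewrite mulrA.
transitivity (\sum_(t <- [seq (q.1, q.2, p.2) | p <- splits a, q <- splits p.1])
                coef f t.1.1 * coef g t.1.2 * coef h t.2); last first.
  rewrite big_allpairs_dep; apply: eq_bigr => p _.
  by rewrite mpsME mulr_suml; apply: eq_bigr.
apply: perm_big; apply: uniq_perm.
- apply: allpairs_uniq_dep => [//|p _ //|].
  move=> [p q] [p' q'] /allpairsPdep[b [c [_ bc [-> ->]]]].
  move=> /allpairsPdep[b' [c' [_ bc' [-> ->]]]] /=.
  move: bc bc'; rewrite !mem_splits => /eqP bc /eqP bc' [e1 e2 e3].
  have ec : c = c' by apply/eqP; rewrite -pair_eqE /pair_eq /= e2 e3 !eqxx.
  have eb : b = b'.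
    by apply/eqP; rewrite -pair_eqE /pair_eq /= -bc -bc' e1 ec !eqxx.
  by rewrite ec eb.
- apply: allpairs_uniq_dep => [//|p _ //|].
  move=> [p q] [p' q'] /allpairsPdep[b [c [_ bc [-> ->]]]].
  move=> /allpairsPdep[b' [c' [_ bc' [-> ->]]]] /=.
  move: bc bc'; rewrite !mem_splits => /eqP bc /eqP bc' [e1 e2 e3].
  have ec : c = c' by apply/eqP; rewrite -pair_eqE /pair_eq /= e1 e2 !eqxx.
  have eb : b = b'.
    by apply/eqP; rewrite -pair_eqE /pair_eq /= -bc -bc' e3 ec !eqxx.
  by rewrite ec eb.
- move=> [[b c] d]; apply/allpairsPdep/allpairsPdep => /=.
    move=> [p [q []]]; rewrite !mem_splits => /eqP pa /eqP qp [-> -> ->].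
    exists (madd p.1 q.1, q.2), (p.1, q.1); split=> //; rewrite mem_splits //=.
    by rewrite -pa -qp; apply/eqP/ffunP => v; rewrite !ffunE addnA.
  move=> [p [q []]]; rewrite !mem_splits => /eqP pa /eqP qp [-> -> ->].
  exists (q.1, madd q.2 p.2), (q.2, p.2); split=> //; rewrite mem_splits //=.
  by rewrite -pa -qp; apply/eqP/ffunP => v; rewrite !ffunE addnA.
Qed.

Lemma mps1M : left_id mps1 mpsM.
Proof.
move=> f; apply: mpseriesP => a; rewrite mpsME.
have a0 : ([ffun=> 0%N], a) \in splits a.
  by rewrite mem_splits; apply/eqP/ffunP => v; rewrite !ffunE.
rewrite (bigD1_seq _ a0 (splits_uniq a)) /= eqxx mul1r big_seq_cond.
rewrite big1 ?addr0 // => -[b c] /andP[]; rewrite mem_splits /= => /eqP bc ne.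
have [b0|b0] := eqVneq b [ffun=> 0%N]; last by rewrite mul0r.
case/eqP: ne; congr pair => //; rewrite -bc b0.
by apply/ffunP => v; rewrite !ffunE.
Qed.

Lemma mpsMDl : left_distributive mpsM mpsD.
Proof.
move=> f g h; apply: mpseriesP => a /=; rewrite -big_split.
by apply: eq_bigr => b _; rewrite mulrDl.
Qed.

Lemma mps1_neq0 : mps1 != mps0.
Proof.
apply/eqP => /(congr1 (fun f => coef f [ffun=> 0%N])) /= /eqP.
by rewrite eqxx oner_eq0.
Qed.

HB.instance Definition _ :=
  GRing.isZmodule.Build (mpseries K V) mpsDA mpsDC mps0D mpsND.
HB.instance Definition _ :=
  GRing.Zmodule_isComNzRing.Build (mpseries K V) mpsMA mpsMC mps1M mpsMDl
    mps1_neq0.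

End PowerSeriesRing.

Section Ideals.
Variable R : comNzRingType.
Implicit Types (G I : set R) (r : R).

Definition ideal_gen G : set R :=
  [set r | exists2 s : seq (R * R), (forall p, p \in s -> G p.2)
                                  & r = \sum_(p <- s) p.1 * p.2].

(* I^k is generated by the products of k elements of I; in particular the
   empty product gives I^0 = R. *)
Definition ideal_pow I (k : nat) : set R :=
  ideal_gen [set r | exists2 u : 'I_k -> R, (forall i, I (u i))
                                          & r = \prod_i u i].

Definition integral_over_ideal I r : Prop :=
  exists (d : nat) (a : nat -> R),
    [/\ (0 < d)%N,
        forall i, (1 <= i <= d)%N -> ideal_pow I i (a i)
      & r ^+ d + \sum_(1 <= i < d.+1) a i * r ^+ (d - i) = 0].

Definition integrally_closed_ideal I : Prop :=
  forall r, integral_over_ideal I r -> I r.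

Definition normal_ideal I : Prop :=
  forall k, (1 <= k)%N -> integrally_closed_ideal (ideal_pow I k).

Definition entries_ideal m n (A : 'M[R]_(m, n)) : set R :=
  ideal_gen [set r | exists i j, r = A i j].

End Ideals.

(* Below, V is a set of names of indeterminates, and X, Y are matrices of names;
   two entries are the same indeterminate exactly when their names are equal. *)
Section IndeterminateMatrices.
Variable V : finType.

Definition generic m n (X : 'M[V]_(m, n)) : Prop :=
  forall i j i' j', X i j = X i' j' -> i = i' /\ j = j'.

Definition generic_symmetric n (X : 'M[V]_n) : Prop :=
  (forall i j, X i j = X j i) /\
  (forall i j i' j' : 'I_n, (i <= j)%N -> (i' <= j')%N ->
     X i j = X i' j' -> i = i' /\ j = j').

Definition disjoint_entries m n p q (X : 'M[V]_(m, n)) (Y : 'M[V]_(p, q)) :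
    Prop :=
  forall i j k l, X i j <> Y k l.

(* V consists exactly of the indeterminates occurring in X and Y. *)
Definition entries_exhaust m n p q (X : 'M[V]_(m, n)) (Y : 'M[V]_(p, q)) :
    Prop :=
  forall v : V, (exists i j, v = X i j) \/ (exists k l, v = Y k l).

Definition indet_mx (K : comNzRingType) m n (X : 'M[V]_(m, n)) :
    'M[mpseries K V]_(m, n) :=
  map_mx (@mpsX K V) X.

End IndeterminateMatrices.

(* Main.v *)
Require Import Defs.
From mathcomp Require Import all_boot all_order all_algebra.
From mathcomp Require Import boolp classical_sets.
From mathcomp Require Import zify ring.
Local Open Scope ring_scope.
Set Implicit Arguments.
Unset Strict Implicit.
Unset Printing Implicit Defensive.
Import GRing.Theory.

(** The proof degenerates the ideal to a squarefree monomial ideal, keeping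
    track of all its powers at once.

    Give the indeterminates positive integral weights, and let the generators
    [gam s] of an ideal [I] have squarefree monomials [tau s] as forms of least
    weight. The set [pow_ge j w] consists of the combinations of products of [j]
    generators whose terms all visibly have weight at least [w]; thus [pow_ge j 0]
    is [I^j]. The crucial point is that an element of [I^j] all of whose terms have
    weight at least [w] lies in [pow_ge j w] (lemma [pow_ge_strict]): no
    cancellation of leading forms can produce anything new. As for Groebner bases,
    this reduces to finitely many exchange relations, namely: if [X^m * tau t] and
    [X^m' * tau s] are the same monomial, then [X^m * gam t - X^m' * gam s] is a
    combination of generators of higher weight. The argument needs
    exchanges only towards a generator [s] selected by the support of the monomial
    under consideration ([peel] and [confluence]).

    Consequently the leading monomials of [I^j] are the monomials divisible by a
    product of [j] of the [tau s], and the selection rule shows that if [mu^d] is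
    divisible by a product of [j * d + 1] of them then [mu] is divisible by a product
    of [j + 1] of them ([level_root]).
    Hence [f] in [I^j] and [f^d] in [I^(j * d + 1)] imply [f] in [I^(j + 1)]
    ([pow_ge_root]): the associated graded ring of [I] is reduced. An equation of
    integral dependence of [r] on [I^k] gives [r^d] in [I^(j * d + 1)] as long as
    [r] is in [I^j] and [j < k], so [r] climbs up to [I^k]
    ([normal_of_standard_basis]).

    For a square matrix, give the diagonal entries and the [y_i] weight 1 and the
    other indeterminates weight 2. Then [g_i] has the leading monomial [x_ii * y_i];
    these monomials are pairwise coprime, and the only exchanges are the Koszul
    ones.

    For an [(n + 1) x n] matrix, put [b_i = x_ii] and [a_i = x_(i + 1, i)], indices
    starting from 0; give the [a_i] and [y_i] weight 1, the [b_i] weight 2 and the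
    entries off these two diagonals a huge weight. Up to terms of huge weight,
    [g_0 = b_0 * y_0] and [g_(i + 1) = a_i * y_i + b_(i + 1) * y_(i + 1)]; the last
    one is [g_n = a_(n - 1) * y_(n - 1)]. The elements [h_0 = g_0] and
    [h_(i + 1) = b_0 ... b_i * g_(i + 1) - a_i * h_i] of the ideal have leading
    monomials [b_0 ... b_i * y_i], and together with the [g_(i + 1)], led by
    [a_i * y_i], they satisfy the exchange relations. The recursion would
    continue with an element [h_n] without leading monomial; the linear relation
    between the [g_i] whose coefficients are the signed maximal minors of the
    matrix shows that [h_n] is a combination of generators of huge weight
    ([chain_last]). *)

(** * Exponents, weights and leading monomials *)

Section Monomials.
Variable V : finType.
Implicit Types (a b c m : {ffun V -> nat}) (U : V -> nat) (S : {set V}).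

Definition wt U a : nat := (\sum_v U v * a v)%N.

Definition sqfree S : {ffun V -> nat} := [ffun v => (v \in S) : nat].

Definition supp a : {set V} := [set v | (0 < a v)%N].

Lemma expD a b v : (a + b) v = (a v + b v)%N.
Proof. by rewrite ffunE. Qed.

Lemma exp0 v : (0 : {ffun V -> nat}) v = 0%N.
Proof. by rewrite ffunE. Qed.

Lemma exp_sqfree S v : sqfree S v = (v \in S).
Proof. by rewrite ffunE. Qed.

Let expE := (expD, exp0, exp_sqfree).

Lemma expMn a d v : (a *+ d) v = (d * a v)%N.
Proof. by elim: d => [|d IH]; rewrite ?mulr0n ?expE // mulrS expE IH mulSn. Qed.

Lemma expDI a b c : a + c = b + c -> a = b.
Proof.
by move/ffunP=> h; apply/ffunP => v; have := h v; rewrite !expE => /eqP; rewrite eqn_add2r => /eqP.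
Qed.

Lemma wtD U a b : wt U (a + b) = (wt U a + wt U b)%N.
Proof.
by rewrite /wt -big_split /=; apply: eq_bigr => v _; rewrite expD mulnDr.
Qed.

Lemma wt0 U : wt U 0 = 0%N.
Proof. by rewrite /wt big1 // => v _; rewrite expE muln0. Qed.

Lemma wtMn U a d : wt U (a *+ d) = (d * wt U a)%N.
Proof. by elim: d => [|d IH]; rewrite ?mulr0n ?wt0 // mulrS wtD IH mulSn. Qed.

Lemma wt_sqfree U S : wt U (sqfree S) = (\sum_(v in S) U v)%N.
Proof.
rewrite /wt [RHS]big_mkcond; apply: eq_bigr => v _.
by rewrite expE; case: (v \in S); rewrite ?muln1 ?muln0.
Qed.

Lemma exp_le_wt U a v : (forall u, 0 < U u)%N -> (a v <= wt U a)%N.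
Proof.
by move=> U0; rewrite /wt (bigD1 v) //= (leq_trans _ (leq_addr _ _)) // leq_pmull.
Qed.

Lemma sqfreeU S S' : [disjoint S & S'] -> sqfree (S :|: S') = sqfree S + sqfree S'.
Proof.
move=> dis; apply/ffunP => v; rewrite !expE inE.
by case vS: (v \in S) => //=; rewrite (disjointFr dis vS).
Qed.

Lemma sqfree_sub S m : S \subset supp m -> exists m', m = m' + sqfree S.
Proof.
move=> sS; exists [ffun v => (m v - (v \in S))%N].
apply/ffunP => v; rewrite !expE ffunE; case vS: (v \in S) => //=; last by rewrite subn0 addn0.
by have := fintype.subsetP sS _ vS; rewrite inE; lia.
Qed.

Lemma suppD a b : supp (a + b) = supp a :|: supp b.
Proof. by apply/setP => v; rewrite !inE expE addn_gt0. Qed.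

Lemma supp_sqfree S : supp (sqfree S) = S.
Proof. by apply/setP => v; rewrite !inE expE; case: (v \in S). Qed.

Lemma supp_Mn a d : (0 < d)%N -> supp (a *+ d) = supp a.
Proof. by move=> d0; apply/setP => v; rewrite !inE expMn muln_gt0 d0. Qed.

End Monomials.

Section Series.
Variables (K : fieldType) (V : finType).
Local Notation R := (mpseries K V).
Implicit Types (f g : R) (a b c m : {ffun V -> nat}) (U : V -> nat).

Lemma coefD f g a : coef (f + g) a = coef f a + coef g a.
Proof. by []. Qed.

Lemma coefN f a : coef (- f) a = - coef f a.
Proof. by []. Qed.

Lemma coefB f g a : coef (f - g) a = coef f a - coef g a.
Proof. by []. Qed.

Lemma coef_sum (I : Type) (r : seq I) (P : pred I) (F : I -> R) a :
  coef (\sum_(i <- r | P i) F i) a = \sum_(i <- r | P i) coef (F i) a.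
Proof. by elim/big_rec2: _ => // i x y _ <-. Qed.

Lemma coefM f g a : coef (f * g) a =
  \sum_(b : {dffun forall v : V, 'I_(a v).+1})
    coef f [ffun v => b v : nat] * coef g [ffun v => (a v - b v)%N].
Proof. by []. Qed.

Lemma coefM_neq0 f g a : coef (f * g) a != 0 ->
  exists b c, [/\ b + c = a, coef f b != 0 & coef g c != 0].
Proof.
move=> h; apply: contrapT => no; move: h; rewrite coefM big1 ?eqxx // => b _.
apply/eqP; rewrite mulf_eq0; apply/negPn/negP; rewrite negb_or => /andP[fb gb].
apply: no; exists [ffun v => b v : nat], [ffun v => (a v - b v)%N]; split=> //.
by apply/ffunP => v; rewrite expD !ffunE subnKC // -ltnS.
Qed.

Lemma coefM_single f g b0 c0 :
    (forall b c, b + c = b0 + c0 -> b != b0 -> coef f b * coef g c = 0) ->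
  coef (f * g) (b0 + c0) = coef f b0 * coef g c0.
Proof.
move=> h; rewrite coefM.
pose B : {dffun forall v : V, 'I_((b0 + c0)%R v).+1} := [ffun v => inord (b0 v)].
have b0_le v : (b0 v < ((b0 + c0)%R v).+1)%N by rewrite ltnS expD leq_addr.
have BE v : B v = b0 v :> nat by rewrite [B v]ffunE inordK.
rewrite (bigD1 B) //= big1 ?addr0 => [|b bB].
  by congr (coef f _ * coef g _); apply/ffunP => v; rewrite [LHS]ffunE BE // expD addKn.
apply: h.
  apply/ffunP => v; rewrite [LHS]expD [X in (X + _)%N]ffunE [X in (_ + X)%N]ffunE.
  by rewrite subnKC // -ltnS.
apply: contra_neq bB => /ffunP e; apply/ffunP => v; apply/val_inj.
transitivity (b0 v); [by rewrite -e [RHS]ffunE | by rewrite -BE].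
Qed.

Definition term (k : K) a : R := MPSeries (fun b => if b == a then k else 0).

Local Notation mon := (term 1).

Lemma coef_termM k a f b : coef (term k a * f) (a + b) = k * coef f b.
Proof.
rewrite coefM_single /= ?eqxx // => c d _ /negPf ->; exact: mul0r.
Qed.

Lemma termM k l a b : term k a * term l b = term (k * l) (a + b).
Proof.
apply: mpseriesP => c; have [->|nc] := eqVneq c (a + b).
  by rewrite coef_termM /= !eqxx.
rewrite [RHS]/= (negPf nc); apply/eqP/negPn/negP => /coefM_neq0[a' [b' [e]]] /=.
have [ea|] := eqVneq a' a; last by rewrite eqxx.
have [eb|] := eqVneq b' b; last by rewrite eqxx.
by move: nc; rewrite -e ea eb eqxx.
Qed.

Lemma term_split k a : term k a = term k 0 * mon a.
Proof. by rewrite termM mulr1 add0r. Qed.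

Lemma mon0 : mon 0 = 1.
Proof. by apply: mpseriesP => a /=; case: (_ == _). Qed.

Lemma mpsX_mon v : mpsX K v = mon (sqfree [set v]).
Proof.
apply: mpseriesP => a /=.
have -> : [ffun w => (w == v) : nat] = sqfree [set v] by apply/ffunP => w; rewrite !ffunE inE.
by case: (_ == _).
Qed.

Definition ord_ge U (w : nat) f : Prop :=
  forall a, (wt U a < w)%N -> coef f a = 0.

Section Weight.
Variable U : V -> nat.
Local Notation F := (ord_ge U).
Local Notation wt := (wt U).

Lemma ord_ge_0 w : F w 0. Proof. by []. Qed.

Lemma ord_geW w w' f : F w f -> (w' <= w)%N -> F w' f.
Proof. by move=> h le a la; apply: h; lia. Qed.

Lemma ord_geD w f g : F w f -> F w g -> F w (f + g).
Proof. by move=> hf hg a la; rewrite coefD hf ?hg ?addr0. Qed.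

Lemma ord_geN w f : F w f -> F w (- f).
Proof. by move=> hf a la; rewrite coefN hf ?oppr0. Qed.

Lemma ord_geB w f g : F w f -> F w g -> F w (f - g).
Proof. by move=> hf hg; apply: ord_geD => //; apply: ord_geN. Qed.

Lemma ord_ge_sum w (I : Type) (r : seq I) (P : pred I) (G : I -> R) :
  (forall i, P i -> F w (G i)) -> F w (\sum_(i <- r | P i) G i).
Proof. by move=> h; elim/big_ind: _ => //; apply: ord_geD. Qed.

Lemma ord_geM w u f g : F w f -> F u g -> F (w + u) (f * g).
Proof.
move=> hf hg a la; apply/eqP/negPn/negP => /coefM_neq0[b [c [e fb gc]]].
have wb : (w <= wt b)%N by rewrite leqNgt; apply: contra_neqN fb => /hf.
have uc : (u <= wt c)%N by rewrite leqNgt; apply: contra_neqN gc => /hg.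
by move: la; rewrite -e wtD; lia.
Qed.

Lemma ord_geMl w f g : F w g -> F w (f * g).
Proof. by move=> hg; apply: (@ord_geM 0). Qed.

Lemma ord_geMr w f g : F w f -> F w (f * g).
Proof. by move=> hf; rewrite mulrC; apply: ord_geMl. Qed.

Lemma ord_ge_term k a : F (wt a) (term k a).
Proof. by move=> b lb /=; case: eqP => // e; move: lb; rewrite e ltnn. Qed.

Lemma ord_ge_termW w k a : (w <= wt a)%N -> F w (term k a).
Proof. by move=> l; exact: ord_geW (@ord_ge_term k a) l. Qed.

Lemma ord_geX w f d : F w f -> F (d * w) (f ^+ d).
Proof. by move=> h; elim: d => [|d IH]; rewrite ?mul0n // exprS mulSn; apply: ord_geM. Qed.

Lemma ord_ge_monI w a f : F w (mon a * f) -> F (w - wt a) f.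
Proof.
by move=> h b lb; rewrite -[LHS]mul1r -(coef_termM 1 a); apply: h; rewrite wtD; lia.
Qed.

Lemma ord_ge_eq0 f : (forall w, F w f) -> f = 0.
Proof. by move=> h; apply: mpseriesP => a; apply: (h (wt a).+1). Qed.

End Weight.

Definition unique_min U f a k : Prop :=
  coef f a = k /\ forall b, coef f b != 0 -> b != a -> (wt U a < wt U b)%N.

Lemma unique_minM U f g a b k l :
  unique_min U f a k -> unique_min U g b l -> unique_min U (f * g) (a + b) (k * l).
Proof.
move=> [fa mf] [gb mg].
have lef c : coef f c != 0 -> (wt U a <= wt U c)%N.
  by move=> fc; have [->//|ne] := eqVneq c a; apply: ltnW; apply: mf.
have leg c : coef g c != 0 -> (wt U b <= wt U c)%N.
  by move=> fc; have [->//|ne] := eqVneq c b; apply: ltnW; apply: mg.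
split=> [|c]; first rewrite coefM_single ?fa ?gb // => a' b' e ne.
  apply/eqP; rewrite mulf_eq0; apply/negPn/negP; rewrite negb_or => /andP[fa' gb'].
  have := congr1 (wt U) e; rewrite !wtD.
  by have := mf _ fa' ne; have := leg _ gb'; lia.
move=> /coefM_neq0[a' [b' [<- fa' gb']]]; rewrite !wtD => ne.
have [ea|na] := eqVneq a' a; last by have := mf _ fa' na; have := leg _ gb'; lia.
have [eb|nb] := eqVneq b' b; first by move: ne; rewrite ea eb eqxx.
by have := mg _ gb' nb; have := lef _ fa'; lia.
Qed.

Lemma unique_minX U f a k d :
  unique_min U f a k -> unique_min U (f ^+ d) (a *+ d) (k ^+ d).
Proof.
move=> h; elim: d => [|d IH]; last by rewrite !exprS mulrS; apply: unique_minM.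
rewrite !expr0 mulr0n -mon0; split=> [|b] /=; first by rewrite eqxx.
by have [->|nb] := eqVneq b 0; rewrite ?eqxx.
Qed.

Lemma ex_min_nat (P : nat -> Prop) :
  (exists k, P k) -> exists2 k, P k & forall l, P l -> (k <= l)%N.
Proof.
move=> [k Pk]; have ex : exists k, `[< P k >] by exists k; apply/asboolP.
exists (ex_minn ex); case: ex_minnP => l /asboolP Pl min //.
by move=> q Pq; apply: min; apply/asboolP.
Qed.

(** A monomial order is replaced by a weight adapted to one series: the support
    of [f] is cut down to a single exponent by minimizing [W] first and then the
    exponents of the indeterminates one after the other. *)
Lemma refine_weight W f : (exists a, coef f a != 0) ->
  exists U a, unique_min U f a (coef f a) /\
    (coef f a != 0 /\ forall b, coef f b != 0 -> (wt W a <= wt W b)%N).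
Proof.
move=> nz.
suff [U [a [fa min_a tie minW]]] : exists U a, [/\ coef f a != 0,
    forall b, coef f b != 0 -> (wt U a <= wt U b)%N,
    forall b, coef f b != 0 -> wt U b = wt U a ->
      wt W b = wt W a /\ {in enum V, forall v, b v = a v} &
    forall b, coef f b != 0 -> (wt W a <= wt W b)%N].
  exists U, a; split=> //; split=> // b fb nba.
  rewrite ltn_neqAle min_a // andbT; apply: contra_neqN nba => /eqP e.
  have [_ h] := tie _ fb (esym e); apply/ffunP => v; apply: h; exact: mem_enum.
elim: (enum V) => [|v vs [U [a [fa min_a tie minW]]]].
  have [_ [a fa <-] min] := @ex_min_nat (fun k => exists2 a, coef f a != 0 & wt W a = k)
    (let: ex_intro a fa := nz in ex_intro _ _ (ex_intro2 _ _ a fa erefl)).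
  by exists W, a; split=> // b fb; apply: min; exists b.
have [_ [a' [fa' ea' <-]] min] := @ex_min_nat
  (fun k => exists b, [/\ coef f b != 0, wt U b = wt U a & b v = k])
  (ex_intro _ _ (ex_intro _ a (And3 fa erefl erefl))).
(* The factor exceeds [a' v], so [U'] compares by [U] first and breaks ties by [v]. *)
pose U' u := ((a' v).+1 * U u + (u == v))%N.
have U'E b : wt U' b = ((a' v).+1 * wt U b + b v)%N.
  rewrite /wt big_distrr /= -[in RHS](mul1n (b v)).
  rewrite (eq_bigr (fun u => ((a' v).+1 * (U u * b u) + (u == v) * b u)%N)) => [|u _].
    rewrite big_split /=; congr (_ + _)%N.
    by rewrite (bigD1 v) //= eqxx big1 ?addn0 // => u /negPf ->.
  by rewrite /U' mulnDl mulnA.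
exists U', a'; split=> // [b fb|b fb|b fb].
- rewrite !U'E; have [e|ne] := eqVneq (wt U b) (wt U a).
    have : (a' v <= b v)%N by apply: min; exists b.
    by rewrite e ea'; lia.
  have : (wt U a < wt U b)%N by rewrite ltn_neqAle eq_sym ne min_a.
  rewrite -ea'; nia.
- rewrite !U'E => e.
  have eU : wt U b = wt U a.
    apply/eqP; rewrite eqn_leq min_a // andbT leqNgt; apply/negP => lt.
    move: e lt; rewrite -ea'; nia.
  have [eW evs] := tie _ fb eU; have [eW' evs'] := tie _ fa' ea'.
  split; first by rewrite eW eW'.
  move=> u; rewrite inE => /orP[/eqP->|uvs]; last by rewrite evs ?evs'.
  by move: e; rewrite eU ea'; lia.
- by have [-> _] := tie _ fa' ea'; apply: minW.
Qed.

End Series.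

(** * Powers of an ideal filtered by weight *)

Section FilteredPowers.
Variables (K : fieldType) (V : finType) (W : V -> nat).
Variables (Gamma : finType) (gam : Gamma -> mpseries K V) (T : Gamma -> {set V}).
Local Notation R := (mpseries K V).
Local Notation F := (@ord_ge K V W).
Local Notation wt := (wt W).
Local Notation mon := (@term K V 1).
Implicit Types (f g h : R) (m mu : {ffun V -> nat}) (l : seq Gamma) (s : Gamma).

Definition tau s : {ffun V -> nat} := sqfree (T s).
Definition taus l : {ffun V -> nat} := \sum_(s <- l) tau s.
Definition gams l : R := \prod_(s <- l) gam s.

Hypothesis gam_lead : forall s, F (wt (tau s)).+1 (gam s - mon (tau s)).
Arguments gam_lead : clear implicits.

(** The truncated subtraction is harmless: when [w] is below the weight of
    [taus t], the coefficient [c t] is unconstrained, as it should be. *)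
Definition pow_ge (j w : nat) f : Prop :=
  exists2 c : j.-tuple Gamma -> R,
    forall t : j.-tuple Gamma, F (w - wt (taus t)) (c t) & f = \sum_t c t * gams t.

Local Notation N := pow_ge.

Lemma taus_cons s l : taus (s :: l) = tau s + taus l.
Proof. by rewrite /taus big_cons. Qed.

Lemma gams_cons s l : gams (s :: l) = gam s * gams l.
Proof. by rewrite /gams big_cons. Qed.

Lemma taus_nil : taus [::] = 0.
Proof. exact: big_nil. Qed.

Lemma gams_cat l l' : gams (l ++ l') = gams l * gams l'.
Proof. by rewrite /gams big_cat. Qed.

Lemma taus_cat l l' : taus (l ++ l') = taus l + taus l'.
Proof. by rewrite /taus big_cat. Qed.

Lemma taus_rem l s : s \in l -> taus l = tau s + taus (rem s l).
Proof. by move=> sl; rewrite -taus_cons /taus; apply: perm_big; apply: perm_to_rem. Qed.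

Lemma gams_rem l s : s \in l -> gams l = gam s * gams (rem s l).
Proof. by move=> sl; rewrite -gams_cons /gams; apply: perm_big; apply: perm_to_rem. Qed.

Lemma gams_tuple k (t : k.-tuple Gamma) : gams t = \prod_i gam (tnth t i).
Proof. exact: big_tuple. Qed.

Lemma gam_ge s : F (wt (tau s)) (gam s).
Proof.
rewrite -(subrK (mon (tau s)) (gam s)); apply: ord_geD; last exact: ord_ge_term.
exact: ord_geW (gam_lead s) _.
Qed.
Arguments gam_ge : clear implicits.

Lemma gams_lead l : F (wt (taus l)).+1 (gams l - mon (taus l)).
Proof.
elim: l => [|s l IH].
  by rewrite /gams /taus !big_nil mon0 subrr; apply: ord_ge_0.
rewrite gams_cons taus_cons wtD.
have -> : mon (tau s + taus l) = mon (tau s) * mon (taus l) by rewrite termM mulr1.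
have -> : gam s * gams l - mon (tau s) * mon (taus l) =
  (gam s - mon (tau s)) * mon (taus l) + gam s * (gams l - mon (taus l)) by ring.
apply: ord_geD; first by rewrite -addSn; apply: ord_geM => //; apply: ord_ge_term.
by rewrite -addnS; apply: ord_geM => //; apply: gam_ge.
Qed.
Arguments gams_lead : clear implicits.

Lemma gams_ge l : F (wt (taus l)) (gams l).
Proof.
rewrite -(subrK (mon (taus l)) (gams l)); apply: ord_geD; last exact: ord_ge_term.
by apply: ord_geW (gams_lead l) _.
Qed.
Arguments gams_ge : clear implicits.

Lemma pow_ge_0 j w : N j w 0.
Proof.
exists (fun=> 0) => [t|]; first exact: ord_ge_0.
by rewrite big1 // => t _; rewrite mul0r.
Qed.

Lemma pow_geD j w f g : N j w f -> N j w g -> N j w (f + g).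
Proof.
move=> [c hc ->] [d hd ->]; exists (fun t => c t + d t) => [t|].
  exact: ord_geD.
by rewrite -big_split; apply: eq_bigr => t _; rewrite mulrDl.
Qed.

Lemma pow_ge_sum j w (I : Type) (r : seq I) (P : pred I) (G : I -> R) :
  (forall i, P i -> N j w (G i)) -> N j w (\sum_(i <- r | P i) G i).
Proof. by move=> h; elim/big_ind: _ => //; [apply: pow_ge_0|apply: pow_geD]. Qed.

Lemma pow_geW j w w' f : N j w f -> (w' <= w)%N -> N j w' f.
Proof.
move=> [c hc ->] le; by exists c => // t; apply: ord_geW (hc t) _; apply: leq_sub2r.
Qed.

Lemma pow_ge_gams l w c : F (w - wt (taus l)) c -> N (size l) w (c * gams l).
Proof.
move=> hc; exists (fun t => if t == in_tuple l then c else 0) => [t|].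
  by case: eqP => [->//|_]; apply: ord_ge_0.
rewrite (bigD1 (in_tuple l)) //= eqxx big1 ?addr0 // => t /negPf ->.
exact: mul0r.
Qed.

Lemma pow_ge_gam s w c : F (w - wt (tau s)) c -> N 1 w (c * gam s).
Proof.
have := @pow_ge_gams [:: s] w c.
by rewrite /gams /taus !big_seq1.
Qed.

Lemma pow_ge_ind j w (P : R -> Prop) :
    P 0 -> (forall f g, P f -> P g -> P (f + g)) ->
    (forall l c, size l = j -> F (w - wt (taus l)) c -> P (c * gams l)) ->
  forall f, N j w f -> P f.
Proof.
move=> P0 PD Pgen _ [c hc ->]; elim/big_ind: _ => // t _.
by apply: Pgen (hc t); apply: size_tuple.
Qed.

Lemma pow_geM j k w u f g : N j w f -> N k u g -> N (j + k) (w + u) (f * g).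
Proof.
move=> hf hg; elim/pow_ge_ind: hf => [|f1 f2 h1 h2|l c sl hc].
- by rewrite mul0r; apply: pow_ge_0.
- by rewrite mulrDl; apply: pow_geD.
elim/pow_ge_ind: hg => [|f1 f2 h1 h2|l' c' sl' hc'].
- by rewrite mulr0; apply: pow_ge_0.
- by rewrite mulrDr; apply: pow_geD.
rewrite mulrACA -gams_cat -sl -sl' -size_cat; apply: pow_ge_gams.
rewrite taus_cat wtD; apply: ord_geW (ord_geM hc hc') _; lia.
Qed.

Lemma pow_ge_ser w c : F w c -> N 0 w c.
Proof.
move=> hc; have := @pow_ge_gams [::] w c.
by rewrite /gams /taus !big_nil mulr1 wt0 subn0; apply.
Qed.

Lemma pow_geMl j w u c f : F u c -> N j w f -> N j (u + w) (c * f).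
Proof. by move=> /pow_ge_ser hc hf; apply: (pow_geM hc hf). Qed.

Lemma pow_geMl0 j w c f : N j w f -> N j w (c * f).
Proof. by move=> hf; apply: (@pow_geMl _ _ 0). Qed.

Lemma pow_geN j w f : N j w f -> N j w (- f).
Proof. by rewrite -mulN1r; apply: pow_geMl0. Qed.

Lemma pow_geB j w f g : N j w f -> N j w g -> N j w (f - g).
Proof. by move=> hf hg; apply: pow_geD => //; apply: pow_geN. Qed.

Lemma pow_ge_gam1 s : N 1 (wt (tau s)) (gam s).
Proof. by rewrite -[gam s]mul1r; apply: pow_ge_gam; rewrite subnn. Qed.
Arguments pow_ge_gam1 : clear implicits.

Lemma pow_ge_gams1 l : N (size l) (wt (taus l)) (gams l).
Proof. by rewrite -[gams l]mul1r; apply: pow_ge_gams; rewrite subnn. Qed.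
Arguments pow_ge_gams1 : clear implicits.

Lemma pow_ge_ord j w f : N j w f -> F w f.
Proof.
elim/pow_ge_ind => [|f1 f2|l c _ hc]; [exact: ord_ge_0|exact: ord_geD|].
by apply: ord_geW (ord_geM hc (gams_ge l)) _; lia.
Qed.

Lemma pow_geS j w f : N j.+1 w f -> N j w f.
Proof.
elim/pow_ge_ind => [|f1 f2|[//|s l] c [sl] hc]; [exact: pow_ge_0|exact: pow_geD|].
rewrite gams_cons mulrA -sl; apply: pow_ge_gams.
move: hc; rewrite taus_cons wtD => hc.
by apply: ord_geW (ord_geM hc (gam_ge s)) _; lia.
Qed.

Lemma pow_ge_le j k w f : (j <= k)%N -> N k w f -> N j w f.
Proof.
by move=> /subnK <-; elim: (k - j)%N => // q IH; rewrite addSn => /pow_geS.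
Qed.

Lemma pow_ge0_ser f : N 0 0 f.
Proof. exact: pow_ge_ser. Qed.

Lemma pow_geX j d f : N j 0 f -> N (d * j) 0 (f ^+ d).
Proof.
move=> hf; elim: d => [|d IH]; first by apply: pow_ge0_ser.
by rewrite exprS mulSn; apply: (pow_geM hf IH).
Qed.

(** The products [gam s * gam t] cancel, which leaves only the parts of higher
    weight of the two generators. *)
Lemma koszul_exchange m s (t : Gamma) :
  N 1 (wt (m + tau s + tau t)).+1 (mon (m + tau s) * gam t - mon (m + tau t) * gam s).
Proof.
have -> : mon (m + tau s) * gam t - mon (m + tau t) * gam s =
    mon m * ((mon (tau s) - gam s) * gam t - (mon (tau t) - gam t) * gam s).
  by rewrite -[1 in LHS]mulr1 -!termM; ring.
rewrite !wtD -addnA -addnS; apply: pow_geMl; first exact: ord_ge_term.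
apply: pow_geB; apply: pow_ge_gam.
  by rewrite -opprB; apply: ord_geN; apply: ord_geW (gam_lead s) _; lia.
by rewrite -opprB; apply: ord_geN; apply: ord_geW (gam_lead t) _; lia.
Qed.

(** The powers of the ideal are closed: the coefficients of the [h w] on a fixed
    product of generators have weights tending to infinity with [w], so that they
    can be summed. *)
Lemma pow_ge_complete j f (h : nat -> R) :
    (forall w, N j w (h w)) -> (forall u, F u (f - \sum_(w < u) h w)) ->
  N j 0 f.
Proof.
move=> hN hf.
pose c w := s2val (cid2 (hN w)).
have cF w (t : j.-tuple Gamma) : F (w - wt (taus t)) (c w t) by exact: (s2valP (cid2 (hN w))).
have hE w : h w = \sum_t c w t * gams t by exact: (s2valP' (cid2 (hN w))).
pose d (t : j.-tuple Gamma) : R :=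
  MPSeries (fun a => \sum_(w < (wt a + wt (taus t)).+1) coef (c w t) a).
have dF u (t : j.-tuple Gamma) : F (u - wt (taus t)) (d t - \sum_(w < u) c w t).
  move=> a la; rewrite coefB coef_sum /=.
  rewrite -(big_mkord xpredT (fun w => coef (c w t) a)).
  rewrite -[X in _ - X](big_mkord xpredT (fun w => coef (c w t) a)).
  rewrite [X in _ - X](big_cat_nat (n := (wt a + wt (taus t)).+1)) //=; last by lia.
  rewrite opprD addrA subrr add0r big_nat_cond big1 ?oppr0 // => w /andP[/andP[lw _] _].
  by apply: cF; lia.
exists d => [t|]; first by rewrite sub0n.
apply/eqP; rewrite -subr_eq0; apply/eqP; apply: (@ord_ge_eq0 _ _ W) => u.
rewrite -(subrK (\sum_(w < u) h w) f) -addrA; apply: ord_geD; first exact: hf.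
rewrite (eq_bigr _ (fun (w : 'I_u) _ => hE w)) exchange_big /= -sumrB.
apply: ord_ge_sum => t _; rewrite -mulr_suml -mulrBl -opprB mulNr; apply: ord_geN.
by apply: ord_geW (ord_geM (dF u t) (gams_ge t)) _; lia.
Qed.

End FilteredPowers.
Arguments gam_ge {K V W Gamma gam T} gam_lead s.
Arguments gams_lead {K V W Gamma gam T} gam_lead l.
Arguments gams_ge {K V W Gamma gam T} gam_lead l.
Arguments pow_ge_gam1 {K V W Gamma gam T} s.
Arguments pow_ge_gams1 {K V W Gamma gam T} l.

(** * A standard basis criterion for normality *)

Section Criterion.
Variables (K : fieldType) (V : finType) (W : V -> nat).
Variables (Gamma : finType) (gam : Gamma -> mpseries K V) (T : Gamma -> {set V}).
(* [sel S s] says that [s] is to be split off first from the monomials of support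
   [S]. *)
Variable sel : {set V} -> Gamma -> Prop.
Local Notation R := (mpseries K V).
Local Notation F := (@ord_ge K V W).
Local Notation wt := (wt W).
Local Notation mon := (@term K V 1).
Local Notation tau := (tau T).
Local Notation taus := (taus T).
Local Notation gams := (gams gam).
Local Notation N := (pow_ge W gam T).
Implicit Types (f g h : R) (m mu : {ffun V -> nat}) (l : seq Gamma) (s : Gamma).

Hypothesis W_gt0 : forall v, (0 < W v)%N.
Hypothesis gam_lead : forall s, F (wt (tau s)).+1 (gam s - mon (tau s)).
Arguments gam_lead : clear implicits.
Hypothesis sel_ex : forall (S : {set V}) (t : Gamma), T t \subset S -> exists s, sel S s.
Hypothesis sel_sub : forall (S : {set V}) s, sel S s -> T s \subset S.
Hypothesis sel_mono : forall (S S' : {set V}) s, sel S s -> S' \subset S -> T s \subset S' -> sel S' s.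
Hypothesis sel_exchange : forall m l s, l != [::] -> s \notin l ->
  sel (supp (m + taus l)) s -> exists (t : Gamma) m', [/\ t \in l, m + tau t = m' + tau s &
    N 1 (wt (m + tau t)).+1 (mon m * gam t - mon m' * gam s)].

(** Either [s] is one of the factors, or one exchange brings it in. *)
Lemma peel m l s : l != [::] -> sel (supp (m + taus l)) s ->
  exists m' l', [/\ size l = (size l').+1, m + taus l = tau s + (m' + taus l') &
    N (size l) (wt (m + taus l)).+1 (mon m * gams l - gam s * (mon m' * gams l'))].
Proof.
move=> l0 sel_s; have [sl|nsl] := boolP (s \in l).
  exists m, (rem s l); split.
  - by rewrite (size_rem sl) prednK // lt0n size_eq0.
  - by rewrite (taus_rem _ sl) addrCA.
  by rewrite (gams_rem _ sl) mulrCA subrr; apply: pow_ge_0.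
have [t [m' [tl em hN]]] := sel_exchange l0 nsl sel_s.
have sz : size l = (size (rem t l)).+1 by rewrite (size_rem tl) prednK // lt0n size_eq0.
exists m', (rem t l); split => //.
  by rewrite (taus_rem _ tl) addrA em addrCA addrA addrAC.
rewrite (taus_rem _ tl) (gams_rem _ tl) sz -add1n addrA wtD -addSn.
have -> : mon m * (gam t * gams (rem t l)) - gam s * (mon m' * gams (rem t l)) =
  (mon m * gam t - mon m' * gam s) * gams (rem t l) by ring.
exact: pow_geM hN (pow_ge_gams1 _).
Qed.

(** Both products have the same leading monomial, hence the same selected factor;
    it is split off from both, and induction applies to what remains. *)
Lemma confluence m m' l l' : size l = size l' -> m + taus l = m' + taus l' ->
  N (size l) (wt (m + taus l)).+1 (mon m * gams l - mon m' * gams l').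
Proof.
elim: {l}(size l) {-2}l m m' l' (erefl (size l)) => [|j IH] l m m' l' sl sl' e.
  have l0 : l = [::] by apply/size0nil.
  have l'0 : l' = [::] by apply/size0nil; rewrite -sl' sl.
  move: e; rewrite l0 l'0 => /expDI ->; rewrite subrr; exact: pow_ge_0.
have l0 : l != [::] by rewrite -size_eq0 sl.
have l'0 : l' != [::] by rewrite -size_eq0 -sl' sl.
have [t tl] : exists t, t \in l by case: l l0 {sl sl' e} => // t l _; exists t; rewrite mem_head.
have [s sel_s] : exists s, sel (supp (m + taus l)) s.
  apply: (sel_ex (t := t)).
  by rewrite (taus_rem _ tl) !suppD supp_sqfree finset.setUCA finset.subsetUl.
have [m1 [l1 [sz1 e1 N1]]] := peel l0 sel_s.
have sel_s' := sel_s; rewrite e in sel_s'.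
have [m2 [l2 [sz2 e2 N2]]] := peel l'0 sel_s'.
have -> : mon m * gams l - mon m' * gams l' =
  (mon m * gams l - gam s * (mon m1 * gams l1)) +
  (gam s * (mon m1 * gams l1 - mon m2 * gams l2)) -
  (mon m' * gams l' - gam s * (mon m2 * gams l2)) by ring.
rewrite sl in N1; rewrite -sl' sl -e in N2; rewrite sl.
apply: pow_geB; last exact: N2.
apply: pow_geD; first exact: N1.
rewrite e1 wtD -add1n -addnS.
apply: pow_geM; first exact: pow_ge_gam1.
have szj : size l1 = j by move: sl; rewrite sz1 => -[].
have szj' : size l2 = j by move: sl'; rewrite sl sz2 => -[].
rewrite -szj; apply: IH => //; first by rewrite szj.
by apply: (@expDI _ _ _ (tau s)); rewrite ![_ + tau s]addrC -e1 -e2.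
Qed.

Definition level (j : nat) mu : Prop :=
  exists m l, size l = j /\ mu = m + taus l.

Lemma level_peel j mu s : level j.+1 mu -> sel (supp mu) s ->
  exists2 nu, mu = nu + tau s & level j nu.
Proof.
move=> [m [l [sl ->]]] sel_s.
have l0 : l != [::] by rewrite -size_eq0 sl.
have [m1 [l1 [sz1 e1 _]]] := peel l0 sel_s.
exists (m1 + taus l1); first by rewrite e1 addrC.
by exists m1, l1; split=> //; move: sl; rewrite sz1 => -[].
Qed.

Lemma level_supp j mu : level j.+1 mu -> exists t, T t \subset supp mu.
Proof.
move=> [m [[|t l] [//= _ ->]]]; exists t.
by rewrite taus_cons !suppD supp_sqfree finset.setUCA finset.subsetUl.
Qed.

Lemma level_cons j nu s : level j nu -> level j.+1 (nu + tau s).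
Proof.
move=> [m [l [sl ->]]]; exists m, (s :: l); split; first by rewrite /= sl.
by rewrite taus_cons -addrA [taus l + _]addrC.
Qed.

(** The selection depends on the support only, so the element selected for [mu]
    can be split off [d] times from [mu *+ d]. *)
Lemma level_root d j mu : (0 < d)%N -> level (j * d).+1 (mu *+ d) -> level j.+1 mu.
Proof.
move=> d0; elim: j mu => [|j IH] mu h;
  have [t] := level_supp h; rewrite supp_Mn // => /sel_ex[s sel_s];
  have [nu enu] := sqfree_sub (sel_sub sel_s); rewrite enu.
  by apply: level_cons; exists nu, [::]; split=> //; rewrite taus_nil addr0.
apply/level_cons/IH.
have strip e q : level (e + q) (nu *+ d + tau s *+ e) -> level q (nu *+ d).
  elim: e => [|e IHe]; first by rewrite mulr0n addr0.
  move=> lev; have [|nu' e' lev'] := level_peel (s := s) lev.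
    apply: sel_mono sel_s _ _; rewrite suppD !supp_Mn // supp_sqfree ?finset.subsetUr //.
    by rewrite enu suppD supp_sqfree.
  apply: IHe; suff -> : nu *+ d + tau s *+ e = nu' by [].
  by apply: (@expDI _ _ _ (tau s)); rewrite -e' mulrSr addrA.
by apply: (strip d); rewrite addnS -mulSn -mulrnDl -enu.
Qed.

Lemma pow_ge_coef j w f mu : N j w f -> (wt mu <= w)%N -> coef f mu != 0 -> level j mu.
Proof.
move=> hf wmu; elim/pow_ge_ind: hf => [|f1 f2 h1 h2|l c sl hc].
- by rewrite eqxx.
- rewrite coefD; have [e1|] := eqVneq (coef f1 mu) 0; last by move/h1.
  by rewrite e1 add0r; apply: h2.
have -> : c * gams l = c * mon (taus l) + c * (gams l - mon (taus l)) by ring.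
rewrite coefD [X in _ + X](_ : _ = 0) ?addr0; last first.
  by apply: (ord_geM hc (gams_lead gam_lead l)); lia.
move=> /coefM_neq0[m [c' [<- _]]] /=.
have [->|] := eqVneq c' (taus l); last by rewrite eqxx.
by exists m, l.
Qed.

(** A fixed element of the [j]-th power with leading monomial [mu]; by
    [confluence], any other choice differs from it by terms of higher weight. *)
Definition rep j mu : R :=
  if pselect (exists ml, size ml.2 = j /\ mu = ml.1 + taus ml.2) is left e
  then mon (projT1 (cid e)).1 * gams (projT1 (cid e)).2 else 0.

Lemma repP j mu : level j mu ->
  exists m l, [/\ size l = j, mu = m + taus l & rep j mu = mon m * gams l].
Proof.
move=> [m [l [sl e]]]; rewrite /rep; case: pselect => [ex|no].
  by case: cid => -[m' l'] /= [sl' e']; exists m', l'.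
by case: no; exists (m, l).
Qed.

Lemma rep_notin j mu : ~ level j mu -> rep j mu = 0.
Proof.
rewrite /rep; case: pselect => // ex no; case: no.
by case: ex => -[m l] []; exists m, l.
Qed.

Lemma rep_ge j mu : N j (wt mu) (rep j mu).
Proof.
have [/repP[m [l [sl e ->]]]|/rep_notin->] := pselect (level j mu); last exact: pow_ge_0.
rewrite -sl; apply: pow_ge_gams; rewrite e wtD addnK; exact: ord_ge_term.
Qed.

(** Exponents of weight at most [w] are bounded by [w], as all weights are
    positive; the box serves to sum over the exponents of weight [w]. *)
Definition box w := {ffun V -> 'I_w.+1}.
Definition box_exp w (b : box w) : {ffun V -> nat} := [ffun v => b v : nat].

Lemma box_exp_inj w : injective (@box_exp w).
Proof.
move=> b c /ffunP e; apply/ffunP => v; apply/val_inj; have := e v.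
by rewrite /box_exp !ffunE.
Qed.

Lemma box_exp_surj w a : (wt a <= w)%N -> exists b : box w, box_exp b = a.
Proof.
move=> le; exists [ffun v => inord (a v)]; apply/ffunP => v.
rewrite /box_exp !ffunE inordK // ltnS; apply: leq_trans le.
exact: exp_le_wt.
Qed.

(** The form of weight [w] of [f], with each monomial [X^mu] replaced by [G mu]. *)
Definition graded (G : {ffun V -> nat} -> R) w f : R :=
  \sum_(b : box w | wt (box_exp b) == w) term (coef f (box_exp b)) 0 * G (box_exp b).

Lemma gradedD G w f g : graded G w (f + g) = graded G w f + graded G w g.
Proof.
rewrite /graded -big_split; apply: eq_bigr => b _; rewrite coefD /= -mulrDl.
congr (_ * _); apply: mpseriesP => a; rewrite coefD /=.
by case: (_ == _); rewrite ?addr0.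
Qed.

Lemma term0 a : term 0 a = 0 :> R.
Proof. by apply: mpseriesP => b /=; case: (_ == _). Qed.

Lemma graded_eq0 G w f :
  (forall mu, wt mu = w -> coef f mu = 0) -> graded G w f = 0.
Proof.
by move=> h; rewrite /graded big1 // => b /eqP wb; rewrite h // term0 mul0r.
Qed.

Lemma graded_coef G w f mu : wt mu = w -> (forall nu, wt nu = w -> nu != mu -> coef f nu = 0) ->
  graded G w f = term (coef f mu) 0 * G mu.
Proof.
move=> wmu h; have [b eb] : exists b : box w, box_exp b = mu.
  by apply: box_exp_surj; rewrite wmu.
rewrite /graded (bigD1 b) /=; last by rewrite eb wmu.
rewrite eb big1 ?addr0 // => c /andP[/eqP wc nc].
rewrite h ?term0 ?mul0r //; apply: contra_neq nc => e.
by apply: box_exp_inj; rewrite e.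
Qed.

Lemma graded_mon w f : F w f -> F w.+1 (f - graded mon w f).
Proof.
move=> hf a; rewrite ltnS leq_eqVlt => /orP[/eqP wa|la]; last first.
  rewrite coefB hf // /graded coef_sum big1 ?subr0 // => b /eqP wb.
  rewrite -term_split; apply: (ord_ge_term (U := W)); by rewrite wb.
have [b eb] : exists b : box w, box_exp b = a by apply: box_exp_surj; rewrite wa.
rewrite coefB /graded coef_sum (bigD1 b); last by rewrite eb wa.
rewrite -term_split [X in _ - (X + _)]/= eb eqxx big1 ?addr0 ?subrr // => c /andP[/eqP wc nc].
rewrite -term_split /=; case: eqP => // e; case/eqP: nc.
by apply: box_exp_inj; rewrite eb.
Qed.

Lemma graded_rep_ge j w f : N j w (graded (rep j) w f).
Proof.
apply: pow_ge_sum => b /eqP wb; apply: pow_geMl0.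
by have := rep_ge j (box_exp b); rewrite wb.
Qed.

(** The form of weight [w] of an element of [pow_ge j w] determines this element
    up to [pow_ge j w.+1]. *)
Lemma graded_rep j w f : N j w f -> N j w.+1 (f - graded (rep j) w f).
Proof.
elim/pow_ge_ind => [|f1 f2 h1 h2|l c sl hc].
- rewrite graded_eq0 ?subr0 //; exact: pow_ge_0.
- by rewrite gradedD opprD addrACA; apply: pow_geD.
have [le|lt] := leqP (wt (taus l)) w; last first.
  rewrite graded_eq0 => [|mu wmu].
    by rewrite subr0 -sl; apply: pow_ge_gams; rewrite (eqP lt).
  by apply: (ord_geMl c (gams_ge gam_lead l)); rewrite wmu.
set w' := (w - _)%N in hc.
have ew : (w' + wt (taus l) = w)%N by rewrite subnK.
pose c0 := graded mon w' c; pose c1 := c - c0.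
have hc1 : F w'.+1 c1 by apply: graded_mon.
have -> : c = c1 + c0 by rewrite subrK.
rewrite mulrDl gradedD opprD addrACA; apply: pow_geD.
  rewrite graded_eq0 => [|mu wmu].
    by rewrite subr0 -sl; apply: pow_ge_gams; apply: ord_geW hc1 _; lia.
  by apply: (ord_geM hc1 (gams_ge gam_lead l)); lia.
rewrite /c0 [graded mon w' c]/graded mulr_suml.
elim/big_rec: _ => [|b g /eqP wb].
  rewrite graded_eq0 ?subr0 //; exact: pow_ge_0.
rewrite gradedD opprD addrACA => IH; apply: pow_geD IH.
set k := coef c _; set m := box_exp b in wb *; set mu := m + taus l.
have wmu : wt mu = w by rewrite wtD wb.
have lead : F w.+1 (term k 0 * mon m * gams l - term k mu).
  have -> : term k 0 * mon m * gams l - term k mu =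
      term k m * (gams l - mon (taus l)).
    by rewrite -term_split mulrBr termM mulr1.
  by rewrite -ew -wb -addnS; apply: ord_geM (gams_lead gam_lead l); apply: ord_ge_term.
have cf nu : wt nu = w -> coef (term k 0 * mon m * gams l) nu = coef (term k mu) nu.
  by move=> wnu; apply/eqP; rewrite -subr_eq0 -coefB lead ?wnu.
rewrite (@graded_coef _ _ _ mu) // => [|nu wnu nn]; last first.
  by rewrite cf //= (negPf nn).
rewrite cf //= eqxx -mulrA -mulrBr; apply: pow_geMl0.
have [|m' [l' [sl' e' ->]]] := @repP j mu; first by exists m, l.
by rewrite -sl -wmu; apply: confluence; rewrite ?sl.
Qed.

Lemma pow_ge_step j w f : N j w f -> F w.+1 f -> N j w.+1 f.
Proof.
move=> /graded_rep + hf; rewrite graded_eq0 ?subr0 // => mu wmu.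
by apply: hf; rewrite wmu.
Qed.

(** This is where confluence pays off: leading forms that cancel in a combination
    of products can be traded for products of higher weight. *)
Lemma pow_ge_strict j w f : N j 0 f -> F w f -> N j w f.
Proof.
move=> h; elim: w => [//|w IH] hf; apply: pow_ge_step => //.
by apply: IH; apply: ord_geW hf _.
Qed.

Lemma rep_lead j mu : level j mu -> F (wt mu).+1 (rep j mu - mon mu).
Proof.
move=> /repP[m [l [_ -> ->]]].
have -> : mon (m + taus l) = mon m * mon (taus l) by rewrite termM mulr1.
rewrite -mulrBr wtD -addnS.
by apply: ord_geM (gams_lead gam_lead l); apply: ord_ge_term.
Qed.

Lemma coef_graded_rep j w f mu : wt mu = w -> level j mu ->
  coef (graded (rep j) w f) mu = coef f mu.
Proof.
move=> wmu lev; have [b eb] : exists b : box w, box_exp b = mu.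
  by apply: box_exp_surj; rewrite wmu.
have coef_rep k nu : wt nu = w -> nu != mu -> coef (term k 0 * rep j nu) mu = 0.
  move=> wnu ne; rewrite -[mu]add0r coef_termM.
  have [levn|nlev] := pselect (level j nu); last by rewrite rep_notin //= mulr0.
  have := rep_lead levn; rewrite wnu => h; have /eqP := h mu (etrans (congr1 (fun x => (x < w.+1)%N) wmu) (ltnSn w)).
  by rewrite coefB subr_eq0 => /eqP->; rewrite /= eq_sym (negPf ne) mulr0.
rewrite /graded coef_sum (bigD1 b); last by rewrite eb wmu.
rewrite big1 => [|c /andP[/eqP wc nc]]; last first.
  apply: coef_rep => //; apply: contra_neq nc => e.
  by apply: box_exp_inj; rewrite e.
rewrite Monoid.mulm1 eb -[mu in coef (_ * _) mu]add0r coef_termM.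
have := rep_lead lev; rewrite wmu => h; have /eqP := h mu (etrans (congr1 (fun x => (x < w.+1)%N) wmu) (ltnSn w)).
by rewrite coefB subr_eq0 => /eqP->; rewrite /= eqxx mulr1.
Qed.

(** Subtracting an element of the power [j.+1] removes the monomials of level
    [j.+1] from the form of weight [w] of [f]. If others were left, then the least
    of them for a refined weight would have its [d]-th power among the leading
    monomials of the power [(j * d).+1], against [level_root]. *)
Lemma root_step d j w f : (0 < d)%N ->
    N j 0 f -> N (j * d).+1 0 (f ^+ d) -> F w f ->
  let f' := f - graded (rep j.+1) w f in
  [/\ N j 0 f', N (j * d).+1 0 (f' ^+ d) & F w.+1 f'].
Proof.
move=> d0 hf hfd hw f'.
have hN : N j.+1 w (graded (rep j.+1) w f) by apply: graded_rep_ge.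
have hN0 := pow_geW hN (leq0n w).
have hf' : N j 0 f' by apply: pow_geB => //; apply: (pow_geS gam_lead).
have hf'd : N (j * d).+1 0 (f' ^+ d).
  rewrite -(subrK (f ^+ d) (f' ^+ d)); apply: pow_geD hfd; rewrite subrXX.
  have -> : f' - f = - graded (rep j.+1) w f by rewrite /f'; ring.
  have -> : (j * d).+1 = (j.+1 + d.-1 * j)%N by case: (d) d0 => //= q _; lia.
  apply: (@pow_geM _ _ _ _ _ _ _ _ 0 0); first exact: pow_geN.
  apply: pow_ge_sum => i _; have -> : d.-1 = (d.-1 - i + i)%N by have := ltn_ord i; lia.
  by rewrite addnK mulnDl; apply: (@pow_geM _ _ _ _ _ _ _ _ 0 0); apply: pow_geX.
have hw' : F w f'.
  by apply: ord_geB => //; apply: (pow_ge_ord gam_lead hN).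
split=> // mu; rewrite ltnS => le_mu; apply/eqP/negPn/negP => nz.
have [U [a [[_ min_a] [fa minW]]]] := @refine_weight _ _ W f' (ex_intro _ mu nz).
have wa : wt a = w.
  apply/eqP; rewrite eqn_leq (leq_trans (minW _ nz) le_mu) /= leqNgt.
  by apply: contraNN fa => /hw'/eqP.
have hX : unique_min U (f' ^+ d) (a *+ d) (coef f' a ^+ d) by apply: unique_minX.
have lev : level (j * d).+1 (a *+ d).
  apply: (pow_ge_coef (w := d * w)).
  - by apply: pow_ge_strict hf'd _; apply: ord_geX hw'.
  - by rewrite wtMn wa.
  by case: hX => -> _; rewrite expf_neq0.
have /negP[] := fa; rewrite /f' coefB coef_graded_rep ?subrr //.
exact: level_root lev.
Qed.

(** Equivalently, the associated graded ring of the ideal is reduced. The elements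
    subtracted by [root_step] for [w = 0, 1, ...] all lie in the power [j.+1], and
    sum up to [f]. *)
Lemma pow_ge_root d j f : (0 < d)%N ->
  N j 0 f -> N (j * d).+1 0 (f ^+ d) -> N j.+1 0 f.
Proof.
move=> d0 hf hfd.
pose fs := fix fs w := if w is w'.+1 then fs w' - graded (rep j.+1) w' (fs w') else f.
have fsP w : [/\ N j 0 (fs w), N (j * d).+1 0 (fs w ^+ d) & F w (fs w)].
  by elim: w => [|w [h1 h2 h3]] //=; apply: root_step.
apply: (pow_ge_complete gam_lead (h := fun w => graded (rep j.+1) w (fs w))) => [w|u].
  exact: graded_rep_ge.
suff -> : f - \sum_(w < u) graded (rep j.+1) w (fs w) = fs u by case: (fsP u).
elim: u => [|u IH]; first by rewrite big_ord0 subr0.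
by rewrite big_ord_recr /= opprD addrA IH.
Qed.

Section Normality.
Variable I : set R.
Hypothesis gamI : forall s, I (gam s).
Hypothesis I_gam : forall r, I r -> N 1 0 r.

Lemma ideal_pow_ge k (J : set R) j r :
  (forall x, J x -> N j 0 x) -> ideal_pow J k r -> N (k * j) 0 r.
Proof.
move=> hJ [s hs ->]; rewrite big_seq; apply: pow_ge_sum => p /hs[u hu ->].
apply: pow_geMl0; elim: k u hu {hs} => [|k IH] u hu.
  by rewrite big_ord0; apply: pow_ge0_ser.
rewrite big_ord_recl mulSn; apply: (@pow_geM _ _ _ _ _ _ _ _ 0 0); first exact: hJ.
by apply: IH.
Qed.

Lemma ge_ideal_pow k r : N k 0 r -> ideal_pow I k r.
Proof.
move=> [c _ ->]; exists [seq (c t, gams t) | t <- enum {: k.-tuple Gamma}].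
  move=> _ /mapP[t _ ->] /=; exists (fun i => gam (tnth t i)) => //.
  exact: gams_tuple.
by rewrite big_map big_enum.
Qed.

Theorem normal_of_standard_basis : normal_ideal I.
Proof.
move=> k k1 r [d [a [d0 ha e]]]; apply: ge_ideal_pow.
have hI x : ideal_pow I k x -> N k 0 x.
  by move=> h; rewrite -[k]muln1; apply: ideal_pow_ge h.
have {}ha i : (1 <= i <= d)%N -> N (i * k) 0 (a i).
  by move=> /ha; apply: ideal_pow_ge.
have step j : (j < k)%N -> N j 0 r -> N j.+1 0 r.
  move=> jk hr; apply: (pow_ge_root d0 hr).
  rewrite -[r ^+ d](addrK (\sum_(1 <= i < d.+1) a i * r ^+ (d - i))) e sub0r.
  apply: pow_geN; rewrite big_nat; apply: pow_ge_sum => i hi.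
  (* As [j < k] and [0 < i], this exponent is greater than [j * d]. *)
  apply: (@pow_ge_le _ _ _ _ _ _ gam_lead _ (i * k + (d - i) * j)).
    have -> : (j * d = i * j + (d - i) * j)%N by rewrite -mulnDl subnKC 1?mulnC; lia.
    rewrite -addSn leq_add2r; nia.
  by apply: (@pow_geM _ _ _ _ _ _ _ _ 0 0); [apply: ha; lia | apply: pow_geX].
suff h j : (j <= k)%N -> N j 0 r by apply: h.
elim: j => [_|j IH jk]; first exact: pow_ge0_ser.
by apply: step => //; apply: IH; apply: ltnW.
Qed.

End Normality.
End Criterion.

(** * Exchanges and generators *)

Section Exchange.
Variables (K : fieldType) (V : finType) (W : V -> nat).
Variables (Gamma : finType) (gam : Gamma -> mpseries K V) (T : Gamma -> {set V}).
Hypothesis gam_lead : forall s,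
  ord_ge W (wt W (tau T s)).+1 (gam s - term 1 (tau T s)).
Arguments gam_lead : clear implicits.

Lemma sub_supp_taus (m : {ffun V -> nat}) (l : seq Gamma) (t : Gamma) :
  t \in l -> T t \subset supp (m + taus T l).
Proof.
elim: l => // s l IH; rewrite inE taus_cons !suppD supp_sqfree.
case/orP=> [/eqP->|tl]; first by rewrite finset.setUCA finset.subsetUl.
move: (IH tl); rewrite suppD => h; apply: fintype.subset_trans h _.
by rewrite finset.setUS // finset.subsetUr.
Qed.

Lemma mem_supp_taus (m : {ffun V -> nat}) (l : seq Gamma) v :
  v \in supp (m + taus T l) -> v \in supp m \/ exists2 t : Gamma, t \in l & v \in T t.
Proof.
elim: l => [|s l IH]; first by rewrite /taus big_nil addr0; left.
rewrite taus_cons addrCA suppD inE supp_sqfree => /orP[vs|/IH[|[t tl vt]]].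
- by right; exists s; rewrite ?mem_head.
- by left.
by right; exists t; rewrite ?inE ?tl ?orbT.
Qed.

Lemma exchange_disjoint m (l : seq Gamma) s : l != [::] -> T s \subset supp m ->
  exists (t : Gamma) m', [/\ t \in l, m + tau T t = m' + tau T s &
    pow_ge W gam T 1 (wt W (m + tau T t)).+1 (term 1 m * gam t - term 1 m' * gam s)].
Proof.
case: l => // t l _ /sqfree_sub[u ->]; exists t, (u + tau T t); split.
- exact: mem_head.
- by rewrite addrAC.
exact: koszul_exchange.
Qed.

End Exchange.

Section Variables.
Variables (K : fieldType) (V : finType) (W : V -> nat).

Lemma wt_var v : wt W (sqfree [set v]) = W v.
Proof. by rewrite wt_sqfree big_set1. Qed.

Lemma ord_ge_var v : ord_ge W (W v) (mpsX K v).
Proof. by rewrite mpsX_mon; apply: ord_ge_termW; rewrite wt_var. Qed.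

Lemma sqfree2 (v w : V) : v != w -> sqfree [set v; w] = sqfree [set v] + sqfree [set w].
Proof. by move=> vw; rewrite sqfreeU // disjoints1 inE. Qed.

Lemma term_sum (I : Type) (r : seq I) (P : pred I) (e : I -> {ffun V -> nat}) :
  term 1 (\sum_(i <- r | P i) e i) = \prod_(i <- r | P i) term 1 (e i) :> mpseries K V.
Proof.
by apply: big_morph => [a b|]; [rewrite termM mulr1 | exact: mon0].
Qed.

End Variables.

Section IdealGen.
Variables (R : comNzRingType) (G : set R).

Lemma mem_ideal_gen r : G r -> ideal_gen G r.
Proof.
move=> Gr; exists [:: (1, r)]; last by rewrite big_seq1 mul1r.
by move=> p; rewrite inE => /eqP ->.
Qed.

Lemma ideal_genD r s : ideal_gen G r -> ideal_gen G s -> ideal_gen G (r + s).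
Proof.
move=> [u hu ->] [v hv ->]; exists (u ++ v); last by rewrite big_cat.
by move=> p; rewrite mem_cat => /orP[/hu|/hv].
Qed.

Lemma ideal_genM c r : ideal_gen G r -> ideal_gen G (c * r).
Proof.
move=> [u hu ->]; exists [seq (c * p.1, p.2) | p <- u].
  by move=> _ /mapP[p pu ->]; apply: (hu p).
by rewrite big_map mulr_sumr; apply: eq_bigr => p _; rewrite mulrA.
Qed.

End IdealGen.

Lemma entries_ideal_col (R : comNzRingType) m (A : 'cV[R]_m) i :
  entries_ideal A (A i 0).
Proof.
by apply: mem_ideal_gen; exists i, 0.
Qed.

(** * Square matrices *)

Section Square.
Variables (K : fieldType) (V : finType) (n : nat) (X : 'M[V]_n) (Y : 'cV[V]_n).
Hypothesis diagX : forall i j k, X i j = X k k -> i = k /\ j = k.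
Hypothesis genY : generic Y.
Hypothesis disXY : disjoint_entries X Y.

Let W (v : V) : nat := if [exists i, (v == X i i) || (v == Y i 0)] then 1 else 2.
Let T (i : 'I_n) : {set V} := [set X i i; Y i 0].
Let g (i : 'I_n) := (indet_mx K X *m indet_mx K Y) i 0.

Let W_diag i : W (X i i) = 1%N.
Proof. by rewrite /W ifT //; apply/existsP; exists i; rewrite eqxx. Qed.

Let W_y i : W (Y i 0) = 1%N.
Proof. by rewrite /W ifT //; apply/existsP; exists i; rewrite eqxx orbT. Qed.

Let W_offdiag i j : i != j -> W (X i j) = 2%N.
Proof.
move=> ij; rewrite /W ifN //; apply/existsPn => k; rewrite negb_or.
apply/andP; split; last by apply/eqP => /disXY.
by apply: contra_neqN ij => /eqP/diagX[-> ->].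
Qed.

Let T_disjoint i k v : v \in T i -> v \in T k -> i = k.
Proof.
rewrite !inE => /orP[]/eqP-> /orP[]/eqP.
- by case/diagX.
- by move/disXY.
- by move/esym/disXY.
by case/genY.
Qed.

Let g_lead i : ord_ge W (wt W (tau T i)).+1 (g i - term 1 (tau T i)).
Proof.
have XY : X i i != Y i 0 by apply/eqP/disXY.
rewrite /tau sqfree2 // wtD !wt_var W_diag W_y.
have -> : term 1 (sqfree [set X i i] + sqfree [set Y i 0]) =
    mpsX K (X i i) * mpsX K (Y i 0) by rewrite !mpsX_mon termM mulr1.
rewrite /g mxE (bigD1 i) //= !mxE addrC addrK; apply: ord_ge_sum => j ji.
rewrite !mxE; apply: ord_geW (ord_geM (@ord_ge_var K V W _) (@ord_ge_var K V W _)) _.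
by rewrite W_offdiag 1?eq_sym // W_y.
Qed.

Theorem normal_square : normal_ideal (entries_ideal (indet_mx K X *m indet_mx K Y)).
Proof.
apply: (@normal_of_standard_basis _ _ W _ g T (fun S i => T i \subset S)) => //.
- by move=> v; rewrite /W; case: ifP.
- by move=> S t; exists t.
- move=> m l s l0 sl sub; apply: exchange_disjoint => //.
  apply/fintype.subsetP => v vs; have := fintype.subsetP sub v vs.
  case/mem_supp_taus => // -[t tl vt]; case/negP: sl.
  by rewrite (T_disjoint vs vt).
- by move=> s; apply: entries_ideal_col.
move=> _ [s hs ->]; rewrite big_seq; apply: pow_ge_sum => p /hs[i [j ->]].
by rewrite ord1; apply: pow_ge_gam.
Qed.

End Square.

(** * Perturbed bidiagonal matrices *)

Section Bidiagonal.
Variables (K : fieldType) (V : finType) (W : V -> nat) (n Q : nat).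
Variables (a b y : nat -> V) (g D : nat -> mpseries K V).
Local Notation R := (mpseries K V).
Local Notation x v := (mpsX K v).
Local Notation F := (@ord_ge K V W).
Local Notation e v := (sqfree [set v]).

Hypothesis n_gt0 : (0 < n)%N.
(* [Q] is the huge weight; dividing by the [b k] costs up to [2 * n] of it, and what is
   left must exceed the weights of the monomials exchanged. *)
Hypothesis leQ : (4 * n + 10 <= Q)%N.
Hypothesis W_gt0 : forall v, (0 < W v)%N.
Hypothesis Wa : forall k, (k < n)%N -> W (a k) = 1%N.
Hypothesis Wy : forall k, (k < n)%N -> W (y k) = 1%N.
Hypothesis Wb : forall k, (k < n)%N -> W (b k) = 2%N.
Hypothesis a_inj : forall j k, (j < n)%N -> (k < n)%N -> a j = a k -> j = k.
Hypothesis y_inj : forall j k, (j < n)%N -> (k < n)%N -> y j = y k -> j = k.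
Hypothesis b_inj : forall j k, (j < n)%N -> (k < n)%N -> b j = b k -> j = k.
Hypothesis ay : forall j k, (j < n)%N -> (k < n)%N -> a j <> y k.
Hypothesis g0_lead : F Q (g 0%N - x (b 0%N) * x (y 0%N)).
Hypothesis g_lead : forall k, (k.+1 < n)%N ->
  F Q (g k.+1 - (x (a k) * x (y k) + x (b k.+1) * x (y k.+1))).
Hypothesis gn_lead : F Q (g n - x (a n.-1) * x (y n.-1)).
Hypothesis relD : \sum_(k < n.+1) D k * g k = 0.
Hypothesis D_last : F Q (D n - \prod_(k < n) x (b k)).
Hypothesis D_rec : forall k, (k < n)%N -> F Q (x (b k) * D k + x (a k) * D k.+1).

Let by_ j k : (j < n)%N -> (k < n)%N -> b j <> y k.
Proof. by move=> hj hk /(congr1 W); rewrite Wb // Wy. Qed.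

Let ab j k : (j < n)%N -> (k < n)%N -> a j <> b k.
Proof. by move=> hj hk /(congr1 W); rewrite Wb // Wa. Qed.

Definition bprod k : R := \prod_(j < k) x (b j).

Fixpoint chain k : R :=
  if k is k'.+1 then bprod k * g k - x (a k') * chain k' else g 0%N.

Let G := (bool * 'I_n)%type.
(** The index [(true, i)] stands for [g i.+1], with leading monomial [a_i * y_i],
    and [(false, i)] for [chain i], with leading monomial [b_0 ... b_i * y_i]. *)
Definition bgen (s : G) : R := if s.1 then g s.2.+1 else chain s.2.
Definition blead (s : G) : {set V} :=
  if s.1 then [set a s.2; y s.2] else y s.2 |: [set b (j : 'I_n) | j : 'I_n & (j <= s.2)%N].
(** Priority goes to the [a_i * y_i]; once no such monomial divides, only chain
    elements occur, and the one of least index comes first. *)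
Definition bselect (S : {set V}) (s : G) : Prop :=
  blead s \subset S /\
  (s.1 = false -> (forall i : 'I_n, ~~ (blead (true, i) \subset S)) /\
     (forall i : 'I_n, (i < s.2)%N -> ~~ (blead (false, i) \subset S))).
Local Notation N := (pow_ge W bgen blead).

Lemma bprodS k : bprod k.+1 = bprod k * x (b k).
Proof. exact: big_ord_recr. Qed.

Let g_bidiag k : (k < n)%N -> exists2 r, F Q r &
  g k.+1 = x (a k) * x (y k) + (if (k.+1 < n)%N then x (b k.+1) * x (y k.+1) else 0) + r.
Proof.
move=> kn; have [lt|ge] := ltnP k.+1 n; eexists.
- exact: g_lead lt.
- by ring.
- exact: gn_lead.
have -> : n = k.+1 by lia.
by rewrite /=; ring.
Qed.

Lemma chain_lead k : (k < n)%N -> F Q (chain k - bprod k.+1 * x (y k)).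
Proof.
elim: k => [|k IH] kn; first by rewrite /bprod big_ord1.
have {}IH := IH (ltnW kn).
rewrite [chain _]/= (bprodS k.+1).
have -> : bprod k.+1 * g k.+1 - x (a k) * chain k - bprod k.+1 * x (b k.+1) * x (y k.+1) =
  bprod k.+1 * (g k.+1 - (x (a k) * x (y k) + x (b k.+1) * x (y k.+1))) -
  x (a k) * (chain k - bprod k.+1 * x (y k)) by ring.
by apply: ord_geB; apply: ord_geMl => //; apply: g_lead.
Qed.

Lemma tau_diag (i : 'I_n) : tau blead (true, i) = e (a i) + e (y i).
Proof. by rewrite /tau /blead sqfree2 //; apply/eqP/ay. Qed.

Lemma tau_chain (i : 'I_n) : tau blead (false, i) = e (y i) + \sum_(j < i.+1) e (b j).
Proof.
rewrite /tau /blead sqfreeU /=; last first.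
  rewrite disjoints1; apply/imsetP => -[j _] /esym; exact: by_.
congr (_ + _); apply/ffunP => v; rewrite exp_sqfree sum_ffunE.
have [/imsetP[j]|nv] := boolP (v \in _).
  rewrite inE => ji -> /=.
  have ji' : (j < i.+1)%N by [].
  rewrite (bigD1 (Ordinal ji')) //= exp_sqfree inE eqxx big1 // => k nk.
  rewrite exp_sqfree inE; case: eqP => // /b_inj bjk; case/eqP: nk; apply: val_inj.
  by rewrite /= bjk // (leq_ltn_trans _ (ltn_ord i)) // -ltnS.
rewrite big1 // => k _; rewrite exp_sqfree inE; case: eqP => // ev.
have kn : (k < n)%N by apply: leq_trans (ltn_ord k) (ltn_ord i).
case/negP: nv; apply/imsetP; exists (Ordinal kn) => //.
by rewrite inE /= -ltnS.
Qed.

Lemma wt_bsum k : (k <= n)%N -> wt W (\sum_(j < k) e (b j)) = (2 * k)%N.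
Proof.
elim: k => [|k IH] kn; first by rewrite big_ord0 wt0.
by rewrite big_ord_recr /= wtD IH 1?ltnW // wt_var Wb //; lia.
Qed.

Lemma wt_tau_diag (i : 'I_n) : wt W (tau blead (true, i)) = 2%N.
Proof. by rewrite tau_diag wtD !wt_var Wa ?Wy. Qed.

Lemma wt_tau_chain (i : 'I_n) : wt W (tau blead (false, i)) = (2 * i + 3)%N.
Proof. by rewrite tau_chain wtD wt_bsum // wt_var Wy //; lia. Qed.

Lemma term_bsum k : term 1 (\sum_(j < k) e (b j)) = bprod k.
Proof. by rewrite term_sum; apply: eq_bigr => j _; rewrite mpsX_mon. Qed.

Lemma term2 v w : term 1 (v + w) = term 1 v * term 1 w :> R.
Proof. by rewrite termM mulr1. Qed.

Lemma bgen_lead s : F (wt W (tau blead s)).+1 (bgen s - term 1 (tau blead s)).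
Proof.
case: s => -[] i.
  rewrite wt_tau_diag tau_diag term2 -!mpsX_mon /bgen /=.
  have [r hr ->] := g_bidiag (ltn_ord i).
  rewrite -[X in X - _]addrA addrAC subrr add0r; apply: ord_geD; last by apply: ord_geW hr _; lia.
  case: ifP => // lt; apply: ord_geW (ord_geM (@ord_ge_var K V W _) (@ord_ge_var K V W _)) _.
  by rewrite Wb // Wy.
rewrite wt_tau_chain tau_chain term2 -mpsX_mon term_bsum /bgen /= mulrC.
by apply: ord_geW (chain_lead (ltn_ord i)) _; have := ltn_ord i; lia.
Qed.

Lemma chain_gam k : (k < n)%N -> exists i : 'I_n, chain k = bgen (false, i) /\ k = i.
Proof. by move=> kn; exists (Ordinal kn). Qed.

Lemma g_gam k : (k <= n)%N -> N 1 0 (g k).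
Proof.
case: k => [|k] kn.
  by apply: (pow_geW (pow_ge_gam1 (gam := bgen) (false, Ordinal n_gt0))).
by apply: (pow_geW (pow_ge_gam1 (gam := bgen) (true, Ordinal kn))).
Qed.

Lemma pow_ge1M w c f : F w c -> N 1 0 f -> N 1 w (c * f).
Proof. by move=> hc hf; rewrite -[w]addn0; apply: pow_geMl. Qed.

Let aprod k : R := (-1) ^+ (n - k) * \prod_(k <= j < n) x (a j).

Let aprodS k : (k < n)%N -> aprod k = - (x (a k) * aprod k.+1).
Proof.
move=> kn; rewrite /aprod subnS; have -> : (n - k = (n - k).-1.+1)%N by lia.
by rewrite big_ltn //= exprS; ring.
Qed.

Let aprodn : aprod n = 1.
Proof. by rewrite /aprod subnn big_geq // expr0 mul1r. Qed.

(** The relations [D_rec] determine the leading forms of the [D k] from that of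
    [D n], by division by [b_k], which lowers the precision by 2. *)
Lemma cofactor_lead k : (k <= n)%N -> F (Q - 2 * k) (D (n - k) - aprod (n - k) * bprod (n - k)).
Proof.
elim: k => [|k IH] kn; first by rewrite muln0 subn0 subn0 aprodn mul1r.
have {}IH := IH (ltnW kn); set q := (n - k.+1)%N.
have qS : (n - k = q.+1)%N by rewrite /q; lia.
rewrite qS in IH; have qn : (q < n)%N by rewrite /q; lia.
have -> : (Q - 2 * k.+1 = Q - 2 * k - wt W (e (b q)))%N by rewrite wt_var Wb //; lia.
apply: ord_ge_monI; rewrite -mpsX_mon.
have -> : x (b q) * (D q - aprod q * bprod q) =
   (x (b q) * D q + x (a q) * D q.+1) - x (a q) * (D q.+1 - aprod q.+1 * bprod q.+1).
  by rewrite aprodS // bprodS; ring.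
apply: ord_geB; last exact: ord_geMl.
by apply: ord_geW (D_rec qn) _; lia.
Qed.

(** The expansion of [chain n] in the [g k] has the leading forms of the [D k] as
    coefficients; subtracting the relation [relD] leaves coefficients of huge
    weight. The induction carries this expansion out one step at a time. *)
Lemma chain_last : N 1 (Q - 2 * n) (chain n).
Proof.
have lead k : (k <= n)%N -> F (Q - 2 * n) (D k - aprod k * bprod k).
  move=> kn; have := @cofactor_lead (n - k) (leq_subr _ _).
  by rewrite subKn // => h; apply: ord_geW h _; lia.
suff h k : (k <= n)%N ->
    N 1 (Q - 2 * n) (aprod (n - k) * chain (n - k) - \sum_(j < (n - k).+1) D j * g j - chain n).
  have := h n (leqnn n); rewrite subnn big_ord1 /= => h0.
  have -> : chain n = - ((D 0%N - aprod 0%N * bprod 0) * g 0%N) - (aprod 0%N * g 0%N - D 0%N * g 0%N - chain n).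
    by rewrite /bprod big_ord0; ring.
  apply: pow_geB h0; apply: pow_geN; apply: pow_ge1M; [exact: lead|exact: g_gam].
elim: k => [_|k IH kn].
  by rewrite subn0 relD aprodn mul1r subr0 subrr; apply: pow_ge_0.
have {}IH := IH (ltnW kn); set q := (n - k.+1)%N.
have qS : (n - k = q.+1)%N by rewrite /q; lia.
rewrite qS in IH; have qn : (q < n)%N by rewrite /q; lia.
rewrite big_ord_recr [chain q.+1]/= in IH.
have -> : aprod q * chain q - \sum_(j < q.+1) D j * g j - chain n =
  (aprod q.+1 * (bprod q.+1 * g q.+1 - x (a q) * chain q) -
   (\sum_(j < q.+1) D j * g j + D q.+1 * g q.+1) - chain n) +
   (D q.+1 - aprod q.+1 * bprod q.+1) * g q.+1 by rewrite aprodS //; ring.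
apply: pow_geD; first exact: IH.
by apply: pow_ge1M; [exact: lead|exact: g_gam].
Qed.

(** Multiplying the recursion for [chain k] by [y_j], each term can be rewritten
    modulo huge weight by the leading forms of [g k.+1] and of [chain j]. *)
Lemma chain_exchange j k : (j <= k < n)%N ->
  N 1 Q (x (y j) * chain k - (\prod_(j.+1 <= q < k.+1) x (b q)) * x (y k) * chain j).
Proof.
case/andP=> /subnK <-; elim: (k - j)%N => [|d IH]; rewrite ?add0n ?addSn => kn.
  by rewrite big_geq // mul1r subrr; apply: pow_ge_0.
move: kn IH; set q := (d + j)%N => kn IH.
have {}IH := IH (ltnW kn).
have jq : (j <= q)%N by rewrite /q; lia.
have N1 k' : (k' < n)%N -> N 1 0 (chain k').
  case/chain_gam => i [-> _]; exact: pow_geW (pow_ge_gam1 _) _.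
rewrite big_nat_recr //=; set E := \prod_(_ <= _ < _) _.
have CE : bprod q.+1 = bprod j.+1 * E.
  by rewrite /bprod /E -!(big_mkord xpredT (fun i => x (b i))) -big_cat_nat.
set r := g q.+1 - (x (a q) * x (y q) + x (b q.+1) * x (y q.+1)).
have -> : x (y j) * (bprod q.+1 * g q.+1 - x (a q) * chain q) -
      E * x (b q.+1) * x (y q.+1) * chain j =
    - (x (a q) * (x (y j) * chain q - E * x (y q) * chain j)) +
    E * r * chain j - E * (chain j - bprod j.+1 * x (y j)) * g q.+1.
  by rewrite CE /r; ring.
apply: pow_geB; first (apply: pow_geD; first by apply: pow_geN; apply: pow_geMl0).
  by apply: pow_ge1M; [apply: ord_geMl; exact: g_lead | apply: N1; lia].
apply: pow_ge1M; last by apply: g_gam; lia.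
by apply: ord_geMl; apply: chain_lead; lia.
Qed.


Let mem_a (i : 'I_n) (t : G) : a i \in blead t -> t = (true, i).
Proof.
case: t => -[] j; rewrite /blead !inE /=.
  case/orP=> /eqP; last by move/ay => /(_ (ltn_ord i) (ltn_ord j)).
  by move/(a_inj (ltn_ord i) (ltn_ord j))/val_inj=> ->.
case/orP=> [/eqP/ay|/imsetP[k _ /ab]]; first by move/(_ (ltn_ord i) (ltn_ord j)).
by move/(_ (ltn_ord i) (ltn_ord k)).
Qed.

Let mem_y (i : 'I_n) (t : G) : y i \in blead t -> t.2 = i.
Proof.
case: t => -[] j; rewrite /blead !inE /=.
  case/orP=> /eqP; first by move/esym/ay => /(_ (ltn_ord j) (ltn_ord i)).
  by move/(y_inj (ltn_ord i) (ltn_ord j))/val_inj=> ->.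
case/orP=> [/eqP|/imsetP[k _ /esym/by_]]; last by move/(_ (ltn_ord k) (ltn_ord i)).
by move/(y_inj (ltn_ord i) (ltn_ord j))/val_inj=> ->.
Qed.

Let in_T1a (i : 'I_n) : a i \in blead (true, i). Proof. by rewrite !inE eqxx. Qed.
Let in_T1y (i : 'I_n) : y i \in blead (true, i). Proof. by rewrite !inE eqxx orbT. Qed.
Let in_T0y (i : 'I_n) : y i \in blead (false, i). Proof. by rewrite !inE eqxx. Qed.

Let split_var v (m : {ffun V -> nat}) : v \in supp m -> exists u, m = u + e v.
Proof. by move=> vm; apply: sqfree_sub; rewrite finset.sub1set. Qed.

(** The difference is a multiple of [chain i.+1], whose weight is higher
    since [b_(i + 1)] outweighs [a_i]. *)
Lemma exchange_diag (i : 'I_n) (u : {ffun V -> nat}) :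
  let m := u + e (a i) in let m' := u + \sum_(j < i.+1) e (b j) in
  m + tau blead (false, i) = m' + tau blead (true, i) /\
  N 1 (wt W (m + tau blead (false, i))).+1
    (term 1 m * bgen (false, i) - term 1 m' * bgen (true, i)).
Proof.
move=> m m'; split.
  rewrite tau_chain tau_diag /m /m' -!addrA; congr (_ + _); rewrite [RHS]addrCA.
  by congr (_ + _); rewrite addrC.
rewrite /m /m' !term2 term_bsum -mpsX_mon.
have -> : term 1 u * x (a i) * bgen (false, i) - term 1 u * bprod i.+1 * bgen (true, i) =
    term 1 u * (- chain i.+1) by rewrite /bgen /=; ring.
rewrite !wtD wt_tau_chain wt_var Wa // -addnA -addnS.
apply: pow_geMl; first exact: ord_ge_term.
apply: pow_geN; have [lt|ge] := ltnP i.+1 n.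
  have := pow_ge_gam1 (W := W) (gam := bgen) (T := blead) (false, Ordinal lt).
  by rewrite wt_tau_chain => h; apply: pow_geW h _; rewrite /=; lia.
have -> : i.+1 = n by have := ltn_ord i; lia.
by apply: pow_geW chain_last _; have := ltn_ord i; lia.
Qed.

Lemma exchange_chain (i j : 'I_n) (u : {ffun V -> nat}) : (i < j)%N ->
  let m := u + e (y i) in
  let m' := u + (\sum_(i.+1 <= q < j.+1) e (b q) + e (y j)) in
  m + tau blead (false, j) = m' + tau blead (false, i) /\
  N 1 (wt W (m + tau blead (false, j))).+1
    (term 1 m * bgen (false, j) - term 1 m' * bgen (false, i)).
Proof.
move=> ij m m'; split.
  rewrite !tau_chain /m /m' -!(big_mkord xpredT (fun q => e (b q))).
  rewrite (big_cat_nat (n := i.+1)) //=; last by rewrite ltnS ltnW.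
  by rewrite -!addrA; congr (_ + _); rewrite [RHS]addrC -!addrA; exact: addrCA.
rewrite /m /m' !term2 term_sum -!mpsX_mon.
rewrite (eq_bigr (fun q => x (b q))) => [|q _]; last by rewrite mpsX_mon.
set E := \prod_(_ <= _ < _) _.
have -> : term 1 u * x (y i) * bgen (false, j) - term 1 u * (E * x (y j)) * bgen (false, i) =
    term 1 u * (x (y i) * chain j - E * x (y j) * chain i) by rewrite /bgen /=; ring.
rewrite !wtD wt_tau_chain wt_var Wy // -addnA -addnS.
apply: pow_geMl; first exact: ord_ge_term.
have := @chain_exchange i j; rewrite ltn_ord ltnW // => /(_ isT) h.
by apply: pow_geW h _; have := ltn_ord j; lia.
Qed.

Lemma bselect_ex (S : {set V}) (t : G) : blead t \subset S -> exists s, bselect S s.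
Proof.
move=> tS; have [[i iS]|noT] := pselect (exists i : 'I_n, blead (true, i) \subset S).
  by exists (true, i).
case: t tS => -[] j jS; first by case: noT; exists j.
have [_ [i [<- iS]] min] := @ex_min_nat
  (fun k => exists i : 'I_n, i = k :> nat /\ blead (false, i) \subset S)
  (ex_intro _ _ (ex_intro _ j (conj erefl jS))).
exists (false, i); split=> // _; split=> k.
  by apply/negP => kS; apply: noT; exists k.
move=> /= ki; apply/negP => kS; have := min k (ex_intro _ k (conj erefl kS)); lia.
Qed.

Lemma bselect_mono (S S' : {set V}) (s : G) :
  bselect S s -> S' \subset S -> blead s \subset S' -> bselect S' s.
Proof.
move=> [_ h] S'S sS'; split=> // /h[h1 h2].
have down (t : G) : ~~ (blead t \subset S) -> ~~ (blead t \subset S').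
  by apply: contra => /fintype.subset_trans; apply.
by split=> [i|i /h2]; apply: down.
Qed.

Lemma bselect_exchange m (l : seq G) s : l != [::] -> s \notin l ->
  bselect (supp (m + taus blead l)) s -> exists (t : G) m', [/\ t \in l,
    m + tau blead t = m' + tau blead s &
    N 1 (wt W (m + tau blead t)).+1 (term 1 m * bgen t - term 1 m' * bgen s)].
Proof.
move=> l0 nsl [/fintype.subsetP sub h].
have koszul := exchange_disjoint bgen_lead l0.
case: s nsl sub h => -[] i nil sub.
  have am : a i \in supp m.
    have [//|[t tl /mem_a et]] := mem_supp_taus (sub _ (in_T1a i)).
    by rewrite et (negPf nil) in tl.
  have [ym _|[t tl yt] _] := mem_supp_taus (sub _ (in_T1y i)).
    apply: koszul; apply/fintype.subsetP => v.
    by rewrite !inE => /orP[]/eqP-> ; move: am ym; rewrite !inE.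
  have et : t = (false, i).
    move: (mem_y yt) tl => {yt}; case: t => -[] j /= -> // il.
    by rewrite il in nil.
  have [u ->] := split_var am; rewrite et in tl.
  have [e1 h1] := exchange_diag i u.
  by exists (false, i), (u + \sum_(j < i.+1) e (b j)).
case=> // noT min.
have onlyF t : t \in l -> t.1 = false.
  case: t => -[] k kl //; have : blead (true, k) \subset supp (m + taus blead l) by exact: sub_supp_taus.
  by rewrite (negPf (noT k)).
have ym : y i \in supp m.
  have [//|[t tl yt]] := mem_supp_taus (sub _ (in_T0y i)).
  move: (mem_y yt) tl => {yt}; case: t => -[] j /= -> il; last by rewrite il in nil.
  by have := onlyF _ il.
have [[t1 k] tl] : exists t, t \in l.
  by case: l l0 {nil sub noT min koszul onlyF} => // t l _; exists t; rewrite mem_head.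
have et1 := onlyF _ tl; rewrite /= in et1; rewrite et1 in tl.
have ik : (i < k)%N.
  rewrite ltn_neqAle; apply/andP; split.
    by apply: contraNneq nil => /val_inj->.
  rewrite leqNgt; apply/negP => /min/negP; apply; exact: sub_supp_taus.
have [u ->] := split_var ym.
have [e1 h1] := exchange_chain u ik.
by exists (false, k); eexists; split; [exact: tl|exact: e1|exact: h1].
Qed.

Theorem normal_bidiagonal :
  normal_ideal (ideal_gen [set r | exists2 k, (k <= n)%N & r = g k]).
Proof.
set gens := ideal_gen _.
apply: (normal_of_standard_basis W_gt0 bgen_lead bselect_ex _ bselect_mono bselect_exchange).
- by move=> S s [].
- have gI k : (k <= n)%N -> gens (g k).
    by move=> kn; apply: mem_ideal_gen; exists k.
  have chainI k : (k < n)%N -> gens (chain k).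
    elim: k => [|k IH] kn; first exact: gI.
    apply: ideal_genD; first by apply: ideal_genM; apply: gI; lia.
    by rewrite -mulNr; apply: ideal_genM; apply: IH; lia.
  by case=> -[] i; [apply: gI | apply: chainI].
move=> _ [r hr ->]; rewrite big_seq; apply: pow_ge_sum => p /hr[k kn ->].
by apply: pow_geMl0; apply: g_gam.
Qed.

End Bidiagonal.

(** * Matrices with one more row than columns *)

Section Rectangular.
Variables (K : fieldType) (V : finType) (p : nat).
Local Notation n := p.+1.
Variables (X : 'M[V]_(n.+1, n)) (Y : 'cV[V]_n).
Hypothesis genX : generic X.
Hypothesis genY : generic Y.
Hypothesis disXY : disjoint_entries X Y.
Local Notation R := (mpseries K V).

Let Q := (4 * n + 10)%N.
Let a k : V := X (inord k.+1) (inord k).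
Let b k : V := X (inord k) (inord k).
Let y k : V := Y (inord k) 0.
Let W v : nat :=
  if [exists i : 'I_n, (v == a i) || (v == y i)] then 1 else
  if [exists i : 'I_n, v == b i] then 2 else Q.
Let M := indet_mx K X.
Let g k : R := (M *m indet_mx K Y) (inord k) 0.
Local Notation F := (@ord_ge K V W).

Let inord_inj m j k : (j <= m)%N -> (k <= m)%N -> inord j = inord k :> 'I_m.+1 -> j = k.
Proof. by move=> hj hk /(congr1 val); rewrite /= !inordK. Qed.

Let a_inj j k : (j < n)%N -> (k < n)%N -> a j = a k -> j = k.
Proof. by move=> hj hk /genX[_ /inord_inj]; apply. Qed.

Let b_inj j k : (j < n)%N -> (k < n)%N -> b j = b k -> j = k.
Proof. by move=> hj hk /genX[_ /inord_inj]; apply. Qed.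

Let y_inj j k : (j < n)%N -> (k < n)%N -> y j = y k -> j = k.
Proof. by move=> hj hk /genY[/inord_inj + _]; apply. Qed.

Let ay j k : (j < n)%N -> (k < n)%N -> a j <> y k.
Proof. by move=> _ _ /disXY. Qed.

Let Wa k : (k < n)%N -> W (a k) = 1%N.
Proof. by move=> kn; rewrite /W ifT //; apply/existsP; exists (Ordinal kn); rewrite eqxx. Qed.

Let Wy k : (k < n)%N -> W (y k) = 1%N.
Proof.
by move=> kn; rewrite /W ifT //; apply/existsP; exists (Ordinal kn); rewrite eqxx orbT.
Qed.

Let Wb k : (k < n)%N -> W (b k) = 2%N.
Proof.
move=> kn; rewrite /W ifN; first by rewrite ifT //; apply/existsP; exists (Ordinal kn).
apply/existsPn => i; rewrite negb_or; apply/andP; split; apply/eqP; last by move/disXY.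
move=> /genX[e1 e2]; have ki : k = i by apply: inord_inj e2; have := ltn_ord i; lia.
have := inord_inj _ _ e1; rewrite ki; have := ltn_ord i; lia.
Qed.

Let W_gt0 v : (0 < W v)%N.
Proof. by rewrite /W; case: ifP => // _; case: ifP. Qed.

Let W_far (i : 'I_n.+1) (j : 'I_n) : i != j :> nat -> i != j.+1 :> nat -> W (X i j) = Q.
Proof.
move=> ij ij1; rewrite /W ifN; last first.
  apply/existsPn => k; rewrite negb_or; apply/andP; split; apply/eqP; last by move/disXY.
  case/genX => ei ej; case/eqP: ij1; rewrite ei ej !inordK //; have := ltn_ord k; lia.
rewrite ifN //; apply/existsPn => k; apply/eqP => /genX[ei ej].
case/eqP: ij; rewrite ei ej !inordK //; have := ltn_ord k; lia.
Qed.

Let near (i : 'I_n.+1) (j : 'I_n) : R :=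
  if (i == j :> nat) || (i == j.+1 :> nat) then M i j else 0.

Let near_far (i : 'I_n.+1) (j : 'I_n) : F Q (M i j - near i j).
Proof.
rewrite /near; case: ifP => [_|/norP[ij ij1]]; first by rewrite subrr; apply: ord_ge_0.
by rewrite subr0 mxE -(W_far ij ij1); apply: ord_ge_var.
Qed.

Let near_b k : (k < n)%N -> near (inord k) (inord k) = mpsX K (b k).
Proof. by move=> kn; rewrite /near !inordK ?eqxx ?mxE //; lia. Qed.

Let near_a k : (k < n)%N -> near (inord k.+1) (inord k) = mpsX K (a k).
Proof. by move=> kn; rewrite /near !inordK ?eqxx ?orbT ?mxE //; lia. Qed.

Let near0 (i : 'I_n.+1) (j : 'I_n) : i != j :> nat -> i != j.+1 :> nat -> near i j = 0.
Proof. by rewrite /near => /negPf-> /negPf->. Qed.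

Let g_near k : F Q (g k - \sum_j near (inord k) j * mpsX K (Y j 0)).
Proof.
rewrite /g mxE -sumrB; apply: ord_ge_sum => j _.
by rewrite [indet_mx K Y j 0]mxE -mulrBl; apply: ord_geMr.
Qed.

Let ord_eq m (j : 'I_m.+1) k : (k <= m)%N -> (j == inord k) = (j == k :> nat).
Proof. by move=> km; rewrite -val_eqE /= inordK. Qed.

Let g0_lead : F Q (g 0%N - mpsX K (b 0%N) * mpsX K (y 0%N)).
Proof.
have := g_near 0; rewrite (bigD1 (inord 0)) //= near_b // big1 ?addr0 // => j.
rewrite ord_eq // => j0; rewrite near0 ?mul0r // inordK //; lia.
Qed.

Let g_lead k : (k.+1 < n)%N ->
  F Q (g k.+1 - (mpsX K (a k) * mpsX K (y k) + mpsX K (b k.+1) * mpsX K (y k.+1))).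
Proof.
move=> kn; have [kp kp1 kp2] : [/\ k <= p, k.+1 <= p & k < n]%N by split; lia.
have := g_near k.+1.
rewrite (bigD1 (inord k)) //= (bigD1 (inord k.+1)) /=; last by rewrite ord_eq ?inordK //; lia.
rewrite near_b // near_a ?(ltnW kn) // big1 ?addr0 // => j.
by rewrite !ord_eq // => /andP[jk jk1]; rewrite near0 ?mul0r // inordK //; lia.
Qed.

Let gn_lead : F Q (g n - mpsX K (a n.-1) * mpsX K (y n.-1)).
Proof.
have := g_near n; rewrite (bigD1 (inord n.-1)) //= near_a // big1 ?addr0 // => j.
rewrite ord_eq // => jn; rewrite near0 ?mul0r // inordK //; have := ltn_ord j; lia.
Qed.

(* The signed maximal minors are the cofactors along an added last column. *)
Let MM : 'M[R]_n.+1 := \matrix_(i, j) if unlift ord_max j is Some j' then M i j' else 0.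
Let D k : R := cofactor MM (inord k) ord_max.

Let relM (j : 'I_n) : \sum_(i < n.+1) D i * M i j = 0.
Proof.
have := congr1 (fun A : 'M_n.+1 => A ord_max (lift ord_max j)) (mul_adj_mx MM).
rewrite !mxE (negPf (neq_lift _ _)) mulr0n => h; apply: etrans h; apply: eq_bigr => i _.
by rewrite [\adj _ _ _]mxE [MM i _]mxE liftK /D inord_val.
Qed.

Let relD : \sum_(k < n.+1) D k * g k = 0.
Proof.
rewrite (eq_bigr (fun k : 'I_n.+1 => \sum_j D k * M k j * indet_mx K Y j 0)) => [|k _].
  rewrite exchange_big big1 //= => j _.
  by rewrite -mulr_suml relM mul0r.
by rewrite /g mxE inord_val mulr_sumr; apply: eq_bigr => j _; rewrite mulrA.
Qed.

Let D_rec k : (k < n)%N -> F Q (mpsX K (b k) * D k + mpsX K (a k) * D k.+1).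
Proof.
move=> kn; have -> : mpsX K (b k) * D k + mpsX K (a k) * D k.+1 =
    - \sum_(i < n.+1) D i * (M i (inord k) - near i (inord k)).
  rewrite (eq_bigr _ (fun i _ => mulrBr _ _ _)) sumrB relM sub0r opprK.
  rewrite (bigD1 (inord k)) //= (bigD1 (inord k.+1)) /=; last first.
    by rewrite ord_eq ?inordK //; lia.
  rewrite near_b // near_a // big1 ?addr0.
    have [k1 k2] : (k < n.+1)%N /\ (k.+1 < n.+1)%N by split; lia.
    by rewrite (inordK k1) (inordK k2); congr (_ + _); rewrite mulrC.
  move=> i; rewrite !ord_eq //; last lia.
  by case/andP=> ik ik1; rewrite near0 ?mulr0 // inordK.
by apply: ord_geN; apply: ord_ge_sum => i _; apply: ord_geMl.
Qed.

Lemma ord_ge_prod (I : finType) w (f h : I -> R) :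
  (forall i, F w (f i - h i)) -> F w (\prod_i f i - \prod_i h i).
Proof.
move=> fh; apply: (big_ind2 (fun f1 h1 : R => F w (f1 - h1))) => // [|f1 h1 f2 h2 e1 e2].
  by rewrite subrr; apply: ord_ge_0.
have -> : f1 * f2 - h1 * h2 = (f1 - h1) * f2 + h1 * (f2 - h2) by ring.
by apply: ord_geD; [apply: ord_geMr|apply: ord_geMl].
Qed.

(* Modulo huge weight, the minor without the last row is triangular. *)
Let D_last : F Q (D n - \prod_(k < n) mpsX K (b k)).
Proof.
have max : inord n = ord_max :> 'I_n.+1 by apply/val_inj; rewrite /= inordK.
rewrite /D max /cofactor -signr_odd oddD addbb mul1r.
pose A' : 'M[R]_n := \matrix_(i, j) near (lift ord_max i) j.
have trig : is_trig_mx A'.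
  apply/is_trig_mxP => i j ij; rewrite mxE near0 // lift_max; lia.
have -> : \prod_(k < n) mpsX K (b k) = \det A'.
  rewrite det_trig //; apply: eq_bigr => i _; rewrite mxE -near_b //.
  congr near; [apply/ord_inj | exact: inord_val].
  by rewrite lift_max inordK // ltnW // ltnS.
rewrite /determinant -sumrB; apply: ord_ge_sum => s _; rewrite -mulrBr.
apply: ord_geMl; apply: ord_ge_prod => i.
by rewrite ![row' _ _ _ _]mxE ![col' _ _ _ _]mxE [MM _ _]mxE liftK [A' _ _]mxE; apply: near_far.
Qed.

Theorem normal_rectangular : normal_ideal (entries_ideal (M *m indet_mx K Y)).
Proof.
have -> : entries_ideal (M *m indet_mx K Y) =
    ideal_gen [set r | exists2 k, (k <= n)%N & r = g k].
  congr ideal_gen; apply/predeqP => r; split.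
    by case=> i [j ->]; exists i; [rewrite -ltnS | rewrite /g inord_val ord1].
  by case=> k kn ->; exists (inord k), 0.
exact: (normal_bidiagonal (ltn0Sn p) (leqnn Q) W_gt0 Wa Wy Wb a_inj y_inj b_inj ay
  g0_lead g_lead gn_lead relD D_last D_rec).
Qed.

End Rectangular.

Theorem corollary4p10 (K : fieldType) (m n : nat) (hm : (1 <= m)%N)
  (hn : (1 <= n)%N) (V : finType) (X : 'M[V]_(m, n)) (Y : 'cV[V]_n)
  (hY : generic Y) (hXY : disjoint_entries X Y) (hV : entries_exhaust X Y)
  (hX : (exists e : m = n,
           generic X \/ generic_symmetric (castmx (e, erefl n) X))
        \/ (m = n.+1 /\ generic X)) :
  normal_ideal (entries_ideal (indet_mx K X *m indet_mx K Y)).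
Proof.
case: hX => [[e]|[e genX]].
  subst m; rewrite castmx_id => hX; apply: normal_square => // i j k eX.
  case: hX => [/(_ _ _ _ _ eX)//|[sym gen]].
  have [ij|ji] := leqP i j; first exact: gen eX.
  by have [-> ->] := gen j i k k (ltnW ji) (leqnn k) (etrans (sym j i) eX).
subst m; clear hm hV; case: n hn X Y hY hXY genX => // p _ X Y hY hXY genX.
exact: normal_rectangular.
Qed.
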